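(* Let $q$ be a prime power, $m\ge1$, $G=\mathrm{SU}_{2m}(q)$ and $x\in G$ unipotent. Then $\mathrm{Sub}_G(x)=G$ unless $x$ is regular, or $x$ has Jordan type $(2m-1,1)$, in which case $\mathrm{Sub}_G(x)$ is $G$-conjugate to $P_m$.
   Context: For $H\le G$ put $S_G(H):=\{g\in G\mid H \text{ is subnormal in } \langle g,H\rangle\}$, and $\mathrm{Sub}_G(x):=\langle S_G(\langle x\rangle)\rangle$ for $x\in G$. Regular means regular unipotent in $\mathrm{SL}_{2m}$, i.e. a single Jordan block of size $2m$. The Jordan type refers to the natural $2m$-dimensional representation over $\mathbb{F}_{q^2}$. The simple roots of the BN-pair of $G$ (with respect to a Borel subgroup $B$ of $G$) are $\alpha_1,\dots,\alpha_m$, where $\alpha_i$ for $i<m$ corresponds to the orbit consisting of the $i$th and $(2m-i)$th node of the Dynkin diagram $A_{2m-1}$, and $\alpha_m$ corresponds to its middle node; $P_m$ is the standard parabolic subgroup containing $B$ whose Levi subgroup has $\alpha_m$ as its only simple root. *)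

(* Defs.v *)
From mathcomp Require Import all_boot all_order all_algebra.
From mathcomp Require Import all_fingroup all_solvable.

Set Implicit Arguments.
Unset Strict Implicit.
Unset Printing Implicit Defensive.

Import GRing.Theory.
Local Open Scope group_scope.

Section Subnormalizer.
Variable gT : finGroupType.
Implicit Types (G H : {set gT}) (x : gT).

Definition subnormalizer_set G H : {set gT} :=
  [set g in G | H <|<| <<g |: H>>].

Definition SubG G x : {set gT} := <<subnormalizer_set G <[x]> >>.

End Subnormalizer.

Section SpecialUnitary.
Variables (F : finFieldType) (n q : nat).
Local Open Scope ring_scope.

(* Elements of {'GL_n[F]} are matrices of size n.-1.+1, which is n for n > 0. *)
Local Notation Mn := 'M[F]_n.-1.+1.

Definition antidiag_mx : Mn := \matrix_(i, j) (j == rev_ord i)%:R.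

(* For #|F| = q ^ 2, a |-> a ^+ q is the involution of F, and the form is the
   split hermitian form \sum_i v_i * (w_(n-1-i)) ^+ q; with this choice the
   triangular matrices of SU form a Borel subgroup. *)
Definition SU : {set {'GL_n[F]}} :=
  [set g : {'GL_n[F]} |
    (GLval g *m antidiag_mx *m (map_mx (fun a => a ^+ q) (GLval g))^T
       == antidiag_mx)
    && (\det (GLval g) == 1)].

Definition unipotent (g : {'GL_n[F]}) : Prop :=
  exists k : nat, (GLval g - 1%:M) ^+ k = 0.

(* Block diagonal matrix whose blocks are the unipotent Jordan blocks of sizes
   lam_0, lam_1, and so on: the superdiagonal entry in column j is 1 unless a
   block starts at j, that is, unless j is a partial sum of lam. *)
Definition unipotent_jordan_mx (lam : seq nat) : Mn :=
  \matrix_(i, j) ((j == i)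
    || ((j == i.+1 :> nat) && ((j : nat) \notin scanl addn 0%N lam)))%:R.

Definition has_jordan_type (lam : seq nat) (g : {'GL_n[F]}) : Prop :=
  sumn lam = n /\ GLval g ~_{in unitmx} unipotent_jordan_mx lam.

Definition regular_unipotent (g : {'GL_n[F]}) : Prop :=
  has_jordan_type [:: n] g.

(* The underlying permutation of the monomial matrix g is s. *)
Definition monomial_for (s : 'S_n.-1.+1) (g : {'GL_n[F]}) : bool :=
  [forall i, forall j, (GLval g i j != 0) == (j == s i)].

(* Upper triangular elements; mathcomp's is_trig_mx means lower triangular. *)
Definition SU_borel : {set {'GL_n[F]}} :=
  [set g in SU | is_trig_mx (GLval g)^T].

(* The k-th node of the Dynkin diagram of type A_(n-1), k = 1, ..., n-1. *)
Definition node_refl (k : nat) : 'S_n.-1.+1 := tperm (inord k.-1) (inord k).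

End SpecialUnitary.

Section EvenSpecialUnitary.
Variables (F : finFieldType) (m q : nat).

(* The simple reflection of the Weyl group of SU_2m for alpha_i, 1 <= i <= m:
   the longest element of the parabolic subgroup of the Weyl group of type
   A_(2m-1) given by the orbit {i, 2m-i} (these two nodes are not adjacent). *)
Definition SU_simple_refl (i : nat) : 'S_(2 * m).-1.+1 :=
  if i == m then node_refl (2 * m)%N m
  else node_refl (2 * m)%N i * node_refl (2 * m)%N (2 * m - i)%N.

(* The preimage N_I, in the group N of monomial matrices of SU_2m, of the
   parabolic subgroup W_I of the Weyl group. *)
Definition SU_weyl_lift (I : seq nat) : {set {'GL_(2 * m)[F]}} :=
  [set g in SU F (2 * m)%N q |
    [exists w in <<[set s in map SU_simple_refl I]>>, monomial_for w g]].

(* P_I = B W_I B, whose standard Levi subgroup has simple roots alpha_i, i in I. *)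
Definition SU_parabolic (I : seq nat) : {set {'GL_(2 * m)[F]}} :=
  SU_borel F (2 * m)%N q * SU_weyl_lift I * SU_borel F (2 * m)%N q.

End EvenSpecialUnitary.

(* Main.v *)
Require Import Defs.
From mathcomp Require Import all_boot all_order all_algebra.
From mathcomp Require Import all_fingroup all_solvable.
From mathcomp Require Import mxrepresentation mxabelem finfield.
From mathcomp Require Import ring zify.

(* A p-element [x] generates a subnormal subgroup of [K] if and only if it lies in
   'O_p(K), so Sub(x) contains every parabolic subgroup having [x] in its unipotent
   radical.

   Write N = x - 1.  If the fixed space of [x] contains a totally isotropic plane,
   there are full isotropic flags G_0, ..., G_(m-1) fixed by [x] such that G_i and
   G_(i+1) differ only in dimension i+1 and [x] fixes all the flags differing from
   G_i only in dimension i+1.  The stabiliser of such a panel lies in Sub(x) and is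
   transitive on the panel; hence Sub(x) is transitive on each of the m panels
   through G_0, so on all flags by connectivity, and it contains the stabiliser of
   G_0: Sub(x) = G.  When there is no isotropic plane of fixed vectors, either the
   fixed space is a line and [x] is regular, or it is a plane containing an
   anisotropic vector, and [x] is regular on the orthogonal of that vector.

   If [x] has type (2m-1, 1), the image W_i of N^(2m-1-i) is, for i < m, the only
   isotropic subspace of dimension at least i inside the kernel of N^i.  This
   characterises W_i in terms of 'O_p(<<g, x>>), so Sub(x) stabilises each W_i. *)

Set Implicit Arguments.
Unset Strict Implicit.
Unset Printing Implicit Defensive.

Import GRing.Theory.
Local Open Scope group_scope.

(** * The split hermitian form and orthogonals of row spaces *)

Section HermitianForm.
Local Open Scope ring_scope.
Variables (F : finFieldType) (s : {rmorphism F -> F}) (n : nat).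
Hypothesis sK : involutive s.
Local Notation d := n.-1.+1.
Local Notation J := (antidiag_mx F n).

(** The shape of the case distinction comes from the construction of the flags. Take isotropic
    chains with dim A_j = dim B_j = j, A_j <= B_(j+1) and B_(j+2) N <= A_j, and put G_i = (A_0, ...,
    A_i, B_(i+1), ..., B_m). If dimension i+1 is omitted from G_i, [x] acts trivially on all
    successive quotients, so it lies in the unipotent radical of the panel stabiliser. The start B_2
    N <= A_0 = 0 of such chains is precisely an isotropic plane of fixed vectors. They can always be
    prolonged, because the drop by two dimensions leaves room for one new vector. In dimension m
    there is no B_(m+1); the condition becomes that N maps the orthogonal of A_(m-1) into A_(m-1),
    and this A_(m-1) comes from an isotropic vector of a skew-hermitian form.

    In the exceptional case all that is known of 'O_p(<<g, x>>) is that it is a p-group containing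
    [x] and normalised by [g]; the powers of its augmentation ideal turn this into [g]-stable
    subspaces. P_m is handled as the stabiliser of the standard isotropic subspaces of dimension
    less than m. *)

Definition hform (u v : 'rV[F]_d) : F := (u *m J *m (map_mx s v)^T) 0 0.

Definition perp k (A : 'M[F]_(k, d)) : 'M[F]_d := kermx (J *m (map_mx s A)^T).

Lemma map_mxK k l : involutive (@map_mx F F s k l).
Proof. by move=> A; apply/matrixP=> i j; rewrite !mxE sK. Qed.

Lemma antidiag_tr : J^T = J.
Proof.
apply/matrixP=> i j; rewrite !mxE -(inj_eq rev_ord_inj i) rev_ordK eq_sym //.
Qed.

Lemma antidiag_map : map_mx s J = J.
Proof. by apply/matrixP=> i j; rewrite !mxE rmorph_nat. Qed.

Lemma row_antidiag k (A : 'M[F]_(k, d)) : A *m J = \matrix_(i, j) A i (rev_ord j).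
Proof.
apply/matrixP=> i j; rewrite !mxE (bigD1 (rev_ord j)) //= big1 => [|l neq].
  by rewrite !mxE rev_ordK eqxx mulr1 addr0.
by rewrite !mxE -(inj_eq rev_ord_inj) rev_ordK eq_sym (negPf neq) mulr0.
Qed.

Lemma antidiag_sq : J *m J = 1%:M.
Proof.
rewrite row_antidiag; apply/matrixP=> i j; rewrite !mxE.
by rewrite (inj_eq rev_ord_inj) eq_sym.
Qed.

Lemma antidiag_unit : J \in unitmx.
Proof. by case: (mulmx1_unit antidiag_sq). Qed.

Lemma sub_perp k l (A : 'M[F]_(k, d)) (B : 'M[F]_(l, d)) :
  (A <= perp B)%MS = (A *m J *m (map_mx s B)^T == 0).
Proof. by rewrite sub_kermx mulmxA. Qed.

Lemma perp_sym k l (A : 'M[F]_(k, d)) (B : 'M[F]_(l, d)) :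
  (A <= perp B)%MS = (B <= perp A)%MS.
Proof.
rewrite !sub_perp -(inj_eq trmx_inj) -(inj_eq (inv_inj (@map_mxK _ _))).
rewrite !trmx_mul trmxK !map_mxM map_mxK antidiag_tr antidiag_map.
by rewrite trmx0 map_mx0 map_trmx mulmxA.
Qed.

Lemma rank_perp k (A : 'M[F]_(k, d)) : (\rank (perp A) + \rank A = d)%N.
Proof.
rewrite mxrank_ker -mxrank_tr trmx_mul trmxK mxrankMfree.
  by rewrite mxrank_map subnK // rank_leq_col.
by rewrite row_free_unit unitmx_tr antidiag_unit.
Qed.

Lemma perpK k (A : 'M[F]_(k, d)) : (perp (perp A) :=: A)%MS.
Proof.
have sA : (A <= perp (perp A))%MS by rewrite perp_sym.
apply/eqmxP; rewrite sA andbT; move: (mxrank_leqif_sup sA) => [_ <-].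
by have := rank_perp A; have := rank_perp (perp A); lia.
Qed.

Lemma perpS k l (A : 'M[F]_(k, d)) (B : 'M[F]_(l, d)) :
  (A <= B)%MS -> (perp B <= perp A)%MS.
Proof. by move=> sAB; rewrite perp_sym (submx_trans sAB) // perpK. Qed.

Lemma perp_subP k l (A : 'M[F]_(k, d)) (B : 'M[F]_(l, d)) :
  (perp A <= perp B)%MS = (B <= A)%MS.
Proof.
apply/idP/idP=> [sAB|]; last exact: perpS.
by have := perpS sAB; rewrite !perpK.
Qed.

Lemma eqmx_perp k l (A : 'M[F]_(k, d)) (B : 'M[F]_(l, d)) :
  (A :=: B)%MS -> (perp A :=: perp B)%MS.
Proof. by move=> eAB; apply/eqmxP; rewrite !perp_subP !eAB !submx_refl. Qed.

Lemma hform_perp u v : (u <= perp v)%MS = (hform u v == 0).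
Proof.
rewrite sub_perp /hform; apply/eqP/eqP=> [-> | h]; first by rewrite mxE.
by apply/matrixP=> i j; rewrite !ord1 h mxE.
Qed.

Lemma hformC u v : hform v u = s (hform u v).
Proof.
transitivity (map_mx s (u *m J *m (map_mx s v)^T)^T 0 0); last by rewrite [LHS]mxE [X in s X]mxE.
rewrite !trmx_mul trmxK !map_mxM map_mxK antidiag_tr antidiag_map -map_trmx.
by rewrite mulmxA.
Qed.

Lemma hformDl u v w : hform (u + v) w = hform u w + hform v w.
Proof. by rewrite /hform !mulmxDl mxE. Qed.
Lemma hformZl a u w : hform (a *: u) w = a * hform u w.
Proof. by rewrite /hform -!scalemxAl mxE. Qed.
Lemma hformDr u v w : hform w (u + v) = hform w u + hform w v.
Proof. by rewrite /hform map_mxD linearD mulmxDr mxE. Qed.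
Lemma hformZr a u w : hform w (a *: u) = s a * hform w u.
Proof. by rewrite /hform map_mxZ linearZ -scalemxAr mxE. Qed.
Lemma hformNl u w : hform (- u) w = - hform u w.
Proof. by rewrite -scaleN1r hformZl mulN1r. Qed.
Lemma hformNr u w : hform w (- u) = - hform w u.
Proof. by rewrite -scaleN1r hformZr rmorphN1 mulN1r. Qed.
Definition hformE := (hformDl, hformDr, hformNl, hformNr, hformZl, hformZr).

Lemma hform_sub k l (A : 'M[F]_(k, d)) (B : 'M[F]_(l, d)) u v :
  (A <= perp B)%MS -> (u <= A)%MS -> (v <= B)%MS -> hform u v = 0.
Proof.
move=> sAB uA vB; apply/eqP; rewrite -hform_perp (submx_trans uA) //.
by rewrite (submx_trans sAB) ?perpS.
Qed.

Lemma perpP k l (A : 'M[F]_(k, d)) (B : 'M[F]_(l, d)) :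
  reflect (forall u v : 'rV_d, (u <= A)%MS -> (v <= B)%MS -> hform u v = 0)
          (A <= perp B)%MS.
Proof.
apply: (iffP idP) => [sAB u v|h]; first exact: hform_sub.
apply/rV_subP=> u uA; rewrite perp_sym; apply/rV_subP=> v vB.
by rewrite hform_perp hformC h ?rmorph0.
Qed.

Lemma perp_adds k l (A : 'M[F]_(k, d)) (B : 'M[F]_(l, d)) j (C : 'M[F]_(j, d)) :
  (C <= perp (A + B)%MS)%MS = (C <= perp A)%MS && (C <= perp B)%MS.
Proof. by rewrite ![(C <= _)%MS]perp_sym addsmx_sub. Qed.

Lemma rank_adds_vec_le k (A : 'M[F]_(k, d)) (u : 'rV_d) :
  (\rank (A + u)%MS <= (\rank A).+1)%N.
Proof. by have := (mxrank_adds_leqif A u).1; have := rank_leq_row u; lia. Qed.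

Lemma rank_adds_vec k (A : 'M[F]_(k, d)) (u : 'rV_d) :
  ~~ (u <= A)%MS -> \rank (A + u)%MS = (\rank A).+1.
Proof.
move=> nuA; apply/eqP; rewrite eqn_leq; apply/andP; split.
  exact: rank_adds_vec_le.
rewrite ltn_neqAle mxrankS ?addsmxSl // andbT.
by rewrite (mxrank_leqif_sup (addsmxSl A u)).2 addsmx_sub submx_refl.
Qed.

Lemma exists_vec k l (A : 'M[F]_(k, d)) (B : 'M[F]_(l, d)) :
  ~~ (A <= B)%MS -> exists2 u : 'rV_d, (u <= A)%MS & ~~ (u <= B)%MS.
Proof. by case/row_subPn=> i hi; exists (row i A); rewrite ?row_sub. Qed.

Lemma adds_vec_eq k l (A : 'M[F]_(k, d)) (B : 'M[F]_(l, d)) (u : 'rV_d) :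
  (A <= B)%MS -> (u <= B)%MS -> ~~ (u <= A)%MS -> (\rank B <= (\rank A).+1)%N ->
  (A + u :=: B)%MS.
Proof.
move=> sAB uB nuA rB; apply/eqmxP; have sB : (A + u <= B)%MS by rewrite addsmx_sub sAB.
rewrite sB /= -(mxrank_leqif_sup sB).2 eqn_leq mxrankS //= rank_adds_vec //.
Qed.

Hypothesis norm_surj : forall c, s c = c -> exists t, t * s t = c.

(** If u is anisotropic, subtract from w its projection on u. Then t u + w' is isotropic once t has
    norm -(w', w') / (u, u), an element fixed by [s]. *)
Lemma exists_isotropic k (A : 'M[F]_(k, d)) :
  (1 < \rank A)%N -> exists2 u : 'rV_d, (u <= A)%MS & (u != 0) && (hform u u == 0).
Proof.
move=> rA; have /exists_vec[u uA nu0] : ~~ (A <= (0 : 'M_d))%MS.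
  by apply/negP=> /mxrankS; rewrite mxrank0; lia.
have /exists_vec[w wA nwu] : ~~ (A <= u)%MS.
  by apply/negP=> /mxrankS; have := rank_leq_row u; lia.
rewrite submx0 in nu0.
have [u0|nu] := eqVneq (hform u u) 0; first by exists u; rewrite // nu0 u0 eqxx.
pose w' := w - (hform w u / hform u u) *: u.
have w'u : hform w' u = 0 by rewrite !hformE divfK // subrr.
have uw' : hform u w' = 0 by rewrite hformC w'u rmorph0.
have uu : s (hform u u) = hform u u by rewrite -hformC.
have ww : s (hform w' w') = hform w' w' by rewrite -hformC.
have [|t tE] := @norm_surj (- hform w' w' / hform u u).
  by rewrite rmorphM rmorphN fmorphV ww uu.
exists (t *: u + w').
  by rewrite addmx_sub ?scalemx_sub // addmx_sub // eqmx_opp scalemx_sub.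
apply/andP; split.
  apply: contra nwu => /eqP h; have -> : w = (t *: u + w') + (hform w u / hform u u - t) *: u.
    by rewrite /w' scalerBl [t *: u + _]addrC -addrA (addrC (t *: u)) !subrK.
  by rewrite h add0r scalemx_sub.
clearbody w'; rewrite hformDl !hformDr !hformZl !hformZr uw' w'u !mulr0 addr0 add0r.
by rewrite mulrA tE divfK // addNr.
Qed.

(** A complement of Z in A still has dimension at least 2. *)
Lemma exists_isotropic_rel k l (A : 'M[F]_(k, d)) (Z : 'M[F]_(l, d)) :
  (Z <= A)%MS -> (\rank Z + 1 < \rank A)%N ->
  exists2 u : 'rV_d, (u <= A)%MS & ~~ (u <= Z)%MS && (hform u u == 0).
Proof.
move=> sZA rA; have [|u] := @exists_isotropic _ (A :\: Z)%MS.
  by have := mxrank_cap_compl A Z; rewrite (capmx_idPr sZA); lia.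
move=> uA /andP[nu0 u0]; exists u; first by rewrite (submx_trans uA) ?diffmxSl.
rewrite u0 andbT; apply: contra nu0 => uZ; rewrite -submx0 -(capmx_diff A Z).
by rewrite sub_capmx uA.
Qed.

End HermitianForm.

(** * Unipotent elements in characteristic p *)

Section UnipotentElements.
Local Open Scope ring_scope.

(** Taking p-th powers is additive on the commuting elements 1 and N, and p^k >= k. *)
Lemma unipotent_exp (R : nzRingType) p (N : R) k :
  p \in [pchar R] -> N ^+ k = 0 -> exists j, (1 + N) ^+ (p ^ j) = 1.
Proof.
move=> pR Nk; have p_pr := pcharf_prime pR.
have powE j : (1 + N) ^+ (p ^ j) = 1 + N ^+ (p ^ j).
  elim: j => [|j IH]; first by rewrite !expr1.
  rewrite expnSr !exprM IH -!(pFrobenius_autE pR).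
  rewrite pFrobenius_autD_comm ?pFrobenius_aut1 //.
  by apply/commr_sym/commr1.
exists k; rewrite powE.
have -> : (p ^ k = k + (p ^ k - k))%N.
  by rewrite subnKC // ltnW // ltn_expl // prime_gt1.
by rewrite exprD Nk mul0r addr0.
Qed.

End UnipotentElements.

Section LinearSubgroups.
Local Open Scope ring_scope.
Variables (F : finFieldType) (n : nat).
Local Notation gT := {'GL_n[F]}.
Variable M : {group gT}.

Lemma mem_GLM (g h : gT) : g \in M -> h \in M -> (g * h)%g \in M.
Proof. exact: groupM. Qed.

Lemma mem_GLV (g : gT) : g \in M -> (g^-1)%g \in M.
Proof. by rewrite groupV. Qed.

End LinearSubgroups.

(** * The special unitary group and its Eichler transformations *)

Section SpecialUnitaryGroup.
Local Open Scope ring_scope.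
Variables (F : finFieldType) (s : {rmorphism F -> F}) (n p : nat).
Hypothesis sK : involutive s.
Local Notation d := n.-1.+1.
Local Notation J := (antidiag_mx F n).
Local Notation hform := (@hform F s n).
Local Notation perp := (@perp F s n _).
Local Notation gT := {'GL_n[F]}.

(* Here [s] stands for [a |-> a ^+ q], see [SU_eq] below. *)
Definition SUs : {set gT} :=
  [set g : gT | (GLval g *m J *m (map_mx s (GLval g))^T == J)
                && (\det (GLval g) == 1)].

Lemma SUs_group_set : group_set SUs.
Proof.
apply/group_setP; split=> [|g h].
  by rewrite inE GL_1E map_mx1 trmx1 mulmx1 mul1mx det1 !eqxx.
rewrite !inE GL_ME => /andP[/eqP gJ /eqP dg] /andP[/eqP hJ /eqP dh].
rewrite det_mulmx dg dh mulr1 eqxx andbT map_mxM trmx_mul.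
by rewrite -!mulmxA (mulmxA J) (mulmxA (GLval h)) (mulmxA (GLval h)) hJ mulmxA gJ.
Qed.
Canonical SUs_group := group SUs_group_set.

Lemma SUs1 : 1%g \in SUs. Proof. exact: (group1 SUs_group). Qed.
Lemma SUsM g h : g \in SUs -> h \in SUs -> (g * h)%g \in SUs.
Proof. exact: (mem_GLM (M := SUs_group)). Qed.
Lemma SUsV g : g \in SUs -> (g^-1)%g \in SUs.
Proof. exact: (mem_GLV (M := SUs_group)). Qed.

Lemma SUs_formE g (u v : 'rV_d) : g \in SUs ->
  hform (u *m GLval g) (v *m GLval g) = hform u v.
Proof.
rewrite inE => /andP[/eqP gJ _]; rewrite /hform map_mxM trmx_mul.
by rewrite -!mulmxA (mulmxA J) (mulmxA (GLval g)) (mulmxA (GLval g)) gJ.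
Qed.

Lemma mulGLK (g : gT) k (A : 'M[F]_(k, d)) : A *m GLval g *m GLval g^-1%g = A.
Proof. by rewrite -mulmxA -GL_MxE mulgV GL_1E mulmx1. Qed.

Lemma mulGLKV (g : gT) k (A : 'M[F]_(k, d)) : A *m GLval g^-1%g *m GLval g = A.
Proof. by rewrite -mulmxA -GL_MxE mulVg GL_1E mulmx1. Qed.

Lemma submxGL (g : gT) k l (A : 'M[F]_(k, d)) (B : 'M[F]_(l, d)) :
  (A *m GLval g <= B *m GLval g)%MS = (A <= B)%MS.
Proof.
apply/idP/idP=> [|/submxMr //]; move/(submxMr (GLval g^-1%g)).
by rewrite !mulGLK.
Qed.

Lemma rankGL (g : gT) k (A : 'M[F]_(k, d)) : \rank (A *m GLval g) = \rank A.
Proof. by rewrite mxrankMfree // row_free_unit GL_unit. Qed.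

Lemma eqmx_of_sub k l (A : 'M[F]_(k, d)) (B : 'M[F]_(l, d)) :
  (A <= B)%MS -> (\rank B <= \rank A)%N -> (A :=: B)%MS.
Proof.
move=> sAB rBA; apply/eqmxP; rewrite sAB -(mxrank_leqif_sup sAB).2.
by rewrite eqn_leq rBA mxrankS.
Qed.

Lemma SUs_perp g k l (A : 'M[F]_(k, d)) (B : 'M[F]_(l, d)) : g \in SUs ->
  (A *m GLval g <= perp (B *m GLval g))%MS = (A <= perp B)%MS.
Proof.
rewrite inE !sub_perp => /andP[/eqP gJ _]; rewrite map_mxM trmx_mul.
by rewrite -!mulmxA (mulmxA J) (mulmxA (GLval g)) (mulmxA (GLval g)) gJ.
Qed.

Lemma perp_mulGL g k (A : 'M[F]_(k, d)) : g \in SUs ->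
  (perp (A *m GLval g) :=: perp A *m GLval g)%MS.
Proof.
move=> gG; apply: eqmx_sym; apply: eqmx_of_sub; first by rewrite SUs_perp.
by rewrite rankGL; have := rank_perp s (A *m GLval g); have := rank_perp s A;
   rewrite rankGL; lia.
Qed.

Lemma gramE k l (A : 'M[F]_(k, d)) (B : 'M[F]_(l, d)) i j :
  (A *m J *m (map_mx s B)^T) i j = hform (row i A) (row j B).
Proof.
by rewrite /hform -row_mul !mxE; apply: eq_bigr => t _; rewrite !mxE.
Qed.

Hypothesis pF : p \in [pchar F].

Lemma pchar_mx : p \in [pchar 'M[F]_d].
Proof. by rewrite pchar_lalg. Qed.

(** The determinant has p-power order in a field of characteristic p, so it is 1. Isometries given
    by a unipotent formula thus lie in the special unitary group. *)
Lemma det_unipotent (N : 'M[F]_d) k : N ^+ k = 0 -> \det (1 + N) = 1.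
Proof.
move=> /(unipotent_exp pchar_mx)[j]; move/(congr1 determinant).
rewrite det1 => hj; have := subrr (1 : F); rewrite -{1}hj.
have detX l (A : 'M[F]_d) : \det (A ^+ l) = (\det A) ^+ l.
  by elim: l => [|l IH]; rewrite ?expr0 ?det1 // !exprS det_mulmx IH.
rewrite detX => h; apply/eqP; rewrite -subr_eq0.
suff: (\det (1 + N) - 1) ^+ (p ^ j) == 0 by rewrite expf_eq0 => /andP[].
apply/eqP; rewrite -[RHS]h; elim: (j) => // l IH; rewrite expnSr !exprM IH.
by rewrite -!(pFrobenius_autE pF) rmorphB /= pFrobenius_aut1.
Qed.

Lemma unipotent_in_SUs (M : 'M[F]_d) k :
  M *m J *m (map_mx s M)^T = J -> (M - 1) ^+ k = 0 ->
  exists2 g : gT, g \in SUs & GLval g = M.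
Proof.
move=> MJ Mk; have dM : \det M = 1 by rewrite -(det_unipotent Mk) addrC subrK.
have uM : M \is a GRing.unit by rewrite -[_ \is a _]/(M \in unitmx) unitmxE dM unitr1.
exists (FinRing.unit _ uM) => //=.
by rewrite inE MJ dM !eqxx.
Qed.

(* For [z = w] these are the unitary transvections. *)
Lemma exists_eichler (z w : 'rV[F]_d) a :
  hform z z = 0 -> hform w w = 0 -> hform z w = 0 ->
  exists2 g : gT, g \in SUs & forall v : 'rV_d,
    v *m GLval g = v + (a * hform v z) *: w - (s a * hform v w) *: z.
Proof.
move=> zz ww zw; have wz : hform w z = 0 by rewrite hformC // zw rmorph0.
pose N : 'M[F]_d := a *: ((J *m (map_mx s z)^T) *m w) - s a *: ((J *m (map_mx s w)^T) *m z).
have vN (v : 'rV_d) : v *m N = (a * hform v z) *: w - (s a * hform v w) *: z.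
  rewrite mulmxBr -!scalemxAr !mulmxA (mx11_scalar (v *m J *m _)).
  by rewrite [v *m J *m (map_mx s w)^T]mx11_scalar !mul_scalar_mx !scalerA.
(* The span of z and w is totally isotropic; it contains the image of N and is killed by N. *)
have N2 : N ^+ 2 = 0.
  have zN : z *m N = 0 by rewrite vN zz zw !mulr0 !scale0r subr0.
  have wN : w *m N = 0 by rewrite vN ww wz !mulr0 !scale0r subr0.
  rewrite expr2 {1}/N -[LHS]/(_ *m _) mulmxBl -!scalemxAl -!mulmxA zN wN.
  by rewrite !mulmx0 !scaler0 subr0.
clearbody N.
have formM u v : hform (u *m (1%:M + N)) (v *m (1%:M + N)) = hform u v.
  have su t : s (hform t t) = hform t t by rewrite -hformC.
  rewrite !mulmxDr !mulmx1 !vN !hformE zz ww zw wz !rmorphM !sK.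
  rewrite -![s (hform v _)]hformC //; ring.
have [|//|g gG gE] := @unipotent_in_SUs (1%:M + N) 2; last 1 first.
- by exists g => // v; rewrite gE mulmxDr mulmx1 vN addrA.
- apply/matrixP=> i j; rewrite gramE.
  have -> : J = 1%:M *m J *m (map_mx s 1%:M)^T.
    by rewrite map_mx1 trmx1 mulmx1 mul1mx.
  by rewrite gramE !rowE !mulmx1; exact: formM.
by rewrite -[1%:M]/1 [1 + N]addrC addrK.
Qed.

End SpecialUnitaryGroup.

(** * Full isotropic flags *)

Section Flags.
Local Open Scope ring_scope.
Variables (F : finFieldType) (s : {rmorphism F -> F}) (n m p : nat).
Hypothesis sK : involutive s.
Local Notation d := n.-1.+1.
Hypothesis dm : d = (2 * m)%N.
Local Notation hform := (@hform F s n).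
Local Notation perp := (@perp F s n _).
Local Notation gT := {'GL_n[F]}.
Local Notation SUs := (SUs s n).
Implicit Types C : nat -> 'M[F]_d.

(* Full flags of totally isotropic subspaces, [C k] having dimension [k]; the
   values of [C] beyond [m] are junk. *)
Definition isflag C := [/\ forall k, (k <= m)%N -> \rank (C k) = k,
  forall k, (k < m)%N -> (C k <= C k.+1)%MS & (C m <= perp (C m))%MS].

Definition upd C i (A : 'M[F]_d) := fun k => if k == i then A else C k.

(** Adjacency of chambers in the building: C' ranges over the panel of C in dimension i. Subspaces
    are compared by [:=:] because the matrices representing a flag are not unique. *)
Definition adjacent i C C' := forall k, (k <= m)%N -> k != i -> (C k :=: C' k)%MS.

Lemma flagS C j k : isflag C -> (j <= k <= m)%N -> (C j <= C k)%MS.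
Proof.
case=> _ CS _; elim: k => [|k IH] h; first by have -> : j = 0%N by lia.
have [->|ne] := eqVneq j k.+1; first exact: submx_refl.
by rewrite (submx_trans (IH _)) ?CS //; lia.
Qed.

Lemma flag_perp C j k : isflag C -> (j <= m)%N -> (k <= m)%N ->
  (C j <= perp (C k))%MS.
Proof.
move=> fC jm km; have [_ _ Cm] := fC.
rewrite (submx_trans (flagS fC (k := m) _)) ?jm ?leqnn //.
by rewrite (submx_trans Cm) // perpS // (flagS fC) // km leqnn.
Qed.

Lemma flag_max C : isflag C -> (perp (C m) :=: C m)%MS.
Proof.
case=> rC _ Cm; apply: eqmx_sym; apply: eqmx_of_sub => //.
by have := rank_perp s (C m); have := rC m (leqnn m); have := dm; lia.
Qed.

Lemma isflag_upd C i A : isflag C -> (0 < i <= m)%N -> \rank A = i ->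
  (C i.-1 <= A)%MS -> ((i < m)%N -> (A <= C i.+1)%MS) ->
  (i = m -> (A <= perp A)%MS) -> isflag (upd C i A).
Proof.
move=> fC i0 rA CA AC Am; have [rC CS Cm] := fC; split=> [k km|k km|]; rewrite /upd.
- by case: eqP => [->|_]; rewrite ?rC.
- case: eqP => [ek|/eqP nk]; case: eqP => [ek1|/eqP nk1]; first by lia.
  + by rewrite ek AC // -ek.
  + by rewrite (_ : k = i.-1) //; lia.
  + exact: CS.
- by case: eqP => [ek|//]; apply: Am.
Qed.

Lemma isotropic_adds k l (A : 'M[F]_(k, d)) (B : 'M[F]_(l, d)) :
  (A <= perp A)%MS -> (B <= perp B)%MS -> (B <= perp A)%MS ->
  ((A + B)%MS <= perp (A + B)%MS)%MS.
Proof.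
move=> AA BB BA; rewrite perp_adds // ![((_ + _)%MS <= _)%MS]addsmx_sub AA BA BB.
by rewrite perp_sym // BA.
Qed.

Lemma exists_vec_rank (A D : 'M[F]_d) : (\rank A < \rank D)%N ->
  exists2 u : 'rV_d, (u <= D)%MS & ~~ (u <= A)%MS.
Proof. by move=> rAD; apply: exists_vec; apply/negP=> /mxrankS; lia. Qed.

(** * Gallery connectivity *)

Section Connectivity.
Variable P : (nat -> 'M[F]_d) -> Prop.
Hypothesis P_adj : forall C C' i, isflag C -> isflag C' -> (0 < i <= m)%N ->
  adjacent i C C' -> P C -> P C'.

(** Partial progress from a flag with P towards C'. Replacing an entry of dimension above j gives an
    adjacent flag, so P and the agreement with C' survive. *)
Let good C' j C := [/\ isflag C, P C & forall l, (l <= j)%N -> (C l :=: C' l)%MS].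

Let upd_good C' j C i A : good C' j C -> (j < i)%N -> (0 < i <= m)%N ->
  \rank A = i -> (C i.-1 <= A)%MS -> ((i < m)%N -> (A <= C i.+1)%MS) ->
  (i = m -> (A <= perp A)%MS) -> good C' j (upd C i A).
Proof.
move=> [fC PC CC'] ji im rA CA AC Am; have fU := isflag_upd fC im rA CA AC Am.
split=> // [|l lj].
  by apply: (P_adj fC fU im _ PC) => k km /negPf ki; rewrite /upd ki.
by rewrite /upd (ltn_eqF (leq_ltn_trans lj ji)); exact: CC'.
Qed.

(* To bring [y] into [C j.+1], first increase the [k] with [y] orthogonal to
   [C k] until [y] lies in [C m] (climb, reach), then decrease the [k] with [y]
   in [C k] (descend). *)
Let climb C' j (y : 'rV_d) : isflag C' -> (j < m)%N -> (y <= C' j.+1)%MS ->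
  (exists C, good C' j C) -> forall k, (j + k < m)%N ->
  exists2 C, good C' j C & (y <= perp (C (j + k)%N))%MS.
Proof.
move=> fC' jm yC' [C0 gC0]; elim=> [|k IH] km.
  exists C0; rewrite // addn0 (submx_trans yC') //.
  case: gC0 => fC0 _ CC'; rewrite (eqmx_perp sK (CC' j _)) // flag_perp //.
  exact: ltnW.
have [|C gC yC] := IH; first by lia.
have [yC1|nyC1] := boolP (y <= perp (C (j + k.+1)%N))%MS; first by exists C.
have [fC _ _] := gC; have [rC CS _] := fC.
(* The orthogonal of y has codimension at most 1, so D has dimension at least j+k+1 and is not
   contained in C (j+k). *)
pose D := (C (j + k).+2 :&: perp y)%MS.
have CD : (C (j + k)%N <= D)%MS.
  rewrite sub_capmx; apply/andP; split; last by rewrite (perp_sym sK).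
  by apply: (flagS fC); apply/andP; split; lia.
have rD : (j + k < \rank D)%N.
  have := mxrank_sum_cap (C (j + k).+2) (perp y).
  have := rank_perp s y; have := rank_leq_row y.
  have := rank_leq_col (C (j + k).+2 + perp y)%MS.
  rewrite [\rank (C _)]rC /D; last by lia.
  generalize (\rank (C (j + k).+2 :&: perp y)%MS) (\rank (perp y)) (\rank y).
  generalize (\rank (C (j + k).+2 + perp y)%MS); clear; lia.
have jkm : (j + k <= m)%N by lia.
have [|u uD nuC] := @exists_vec_rank (C (j + k)%N) D; first by rewrite rC.
have uCD : (C (j + k)%N + u <= D)%MS by rewrite addsmx_sub CD.
exists (upd C (j + k.+1) (C (j + k)%N + u)%MS).
  have [h1 h2] : (j < j + k.+1)%N /\ (0 < j + k.+1 <= m)%N by lia.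
  apply: (upd_good gC h1 h2).
  - by rewrite rank_adds_vec // rC // addnS.
  - by rewrite addnS addsmxSl.
  - by move=> _; rewrite addnS (submx_trans uCD) // capmxSl.
  - by move=> ekm; move: km; rewrite ekm ltnn.
by rewrite /upd eqxx perp_sym // (submx_trans uCD) // capmxSr.
Qed.

Let reach C' j (y : 'rV_d) : isflag C' -> (j < m)%N -> (y <= C' j.+1)%MS ->
  (exists C, good C' j C) -> exists2 C, good C' j C & (y <= C m)%MS.
Proof.
move=> fC' jm yC' eC; have [|C gC yC] := climb (k := m.-1 - j) fC' jm yC' eC.
  by lia.
have em : (j + (m.-1 - j) = m.-1)%N by lia.
rewrite em in yC; have [fC _ _] := gC; have [rC CS Cm] := fC.
have [yC1|nyC1] := boolP (y <= C m.-1)%MS.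
  by exists C; rewrite // (submx_trans yC1) // (flagS fC) // leq_pred leqnn.
exists (upd C m (C m.-1 + y)%MS); last by rewrite /upd eqxx addsmxSr.
have m1 : (m.-1 <= m)%N by lia.
have m0 : (0 < m <= m)%N by rewrite leqnn (leq_ltn_trans (leq0n j)).
apply: (upd_good gC jm m0).
- by rewrite rank_adds_vec // rC // prednK // (leq_ltn_trans (leq0n j)).
- exact: addsmxSl.
- by rewrite ltnn.
move=> _; apply: isotropic_adds => //; first by rewrite flag_perp.
by rewrite (submx_trans yC') // (submx_trans (flag_perp fC' (k := j.+1) _ _)) // perpS.
Qed.

Let descend C' j (y : 'rV_d) : isflag C' -> (j < m)%N -> (y <= C' j.+1)%MS ->
  (exists C, good C' j C) -> forall t, (j + t < m)%N ->
  exists2 C, good C' j C & (y <= C (m - t)%N)%MS.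
Proof.
move=> fC' jm yC' eC; elim=> [|t IH] tm; first by rewrite subn0; apply: reach eC.
have [|C gC yC] := IH; first by lia.
have [yC1|nyC1] := boolP (y <= C (m - t.+1)%N)%MS; first by exists C.
have [fC _ _] := gC; have [rC CS Cm] := fC.
set k := (m - t.+1)%N in nyC1 *.
have ek : (m - t = k.+1)%N by rewrite /k; lia.
have k0 : (0 < k)%N by rewrite /k; lia.
have km : (k < m)%N by rewrite /k; lia.
have jk : (j < k)%N by rewrite /k; lia.
clearbody k; rewrite ek in yC.
have C1 : (C k.-1 <= C k)%MS by apply: (flagS fC); lia.
have C2 : (C k.-1 <= C k.+1)%MS by apply: (flagS fC); lia.
exists (upd C k (C k.-1 + y)%MS); last by rewrite /upd eqxx addsmxSr.
have k0m : (0 < k <= m)%N by rewrite k0 ltnW.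
apply: (upd_good gC jk k0m).
- rewrite rank_adds_vec; first by rewrite rC ?prednK // (leq_trans (leq_pred _)) // ltnW.
  by apply: contra nyC1 => /submx_trans; apply.
- exact: addsmxSl.
- by rewrite addsmx_sub C2.
- by move=> ekm; rewrite ekm ltnn in km.
Qed.

Lemma flag_connected C C' : (0 < m)%N -> isflag C -> isflag C' -> P C -> P C'.
Proof.
move=> m0 fC fC' PC.
have gC0 : exists C1, good C' 0 C1.
  exists C; split=> // l; rewrite leqn0 => /eqP ->.
  have [[rC _ _] [rC' _ _]] := (fC, fC').
  have C0 : C 0%N = 0 by apply/eqP; rewrite -mxrank_eq0 rC.
  have C'0 : C' 0%N = 0 by apply/eqP; rewrite -mxrank_eq0 rC'.
  by rewrite C0 C'0.
have gC j : (j <= m)%N -> exists C1, good C' j C1.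
  elim: j => // j IH jm; have {IH}eC := IH (ltnW jm).
  have [rC' CS' _] := fC'.
  have [|y yC' nyC'] := @exists_vec_rank (C' j) (C' j.+1).
    by rewrite !rC' // ltnW.
  have [|C1 gC1 yC1] := descend (t := m - j.+1) fC' jm yC' eC; first by lia.
  have et : (m - (m - j.+1) = j.+1)%N by lia.
  rewrite et in yC1; have [fC1 PC1 CC1] := gC1; have [rC1 CS1 _] := fC1.
  have Cj := CC1 j (leqnn j).
  exists C1; split=> // l; rewrite leq_eqVlt => /orP[/eqP ->|]; last exact: CC1.
  have h : (C' j + y <= C1 j.+1)%MS by rewrite addsmx_sub -Cj CS1.
  have h' : (C' j + y :=: C' j.+1)%MS.
    by apply: adds_vec_eq => //; rewrite ?CS' // !rC' // ltnW.
  rewrite h' in h; apply: eqmx_sym; apply: eqmx_of_sub => //.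
  by rewrite rC1 // rC'.
have [C1 [fC1 PC1 CC1]] := gC m (leqnn m).
(* C1 and C' are now the same flag, possibly given by different matrices; in particular they are
   adjacent. *)
by apply: (P_adj (C := C1) (i := 1)) => // k km _; apply: CC1.
Qed.

End Connectivity.

(** * Transitivity of the unitary group on flags *)

Hypothesis pF : p \in [pchar F].
Hypothesis s_nontriv : exists a, s a != a.

(** This plays the part of 1/2 and exists in characteristic 2 as well. *)
Lemma exists_trace1 : exists c, c + s c = 1.
Proof.
have [a na] := s_nontriv; exists (- s a / (a - s a)).
have nas : a - s a != 0 by rewrite subr_eq0 eq_sym.
rewrite fmorph_div rmorphN rmorphB !sK -[s a - a]opprB invrN mulrNN.
by rewrite -mulrDl addrC divff.
Qed.

(** Completes u to a hyperbolic pair inside the orthogonal of Z. As u is outside Z =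
    [perp (perp Z)], some w1 in [perp Z] has (u, w1) = 1; adding t u with t + s t = -(w1, w1) makes
    it isotropic. *)
Lemma exists_eichler_partner k (Z : 'M[F]_(k, d)) (u : 'rV_d) :
  (Z <= perp Z)%MS -> (u <= perp Z)%MS -> hform u u = 0 -> ~~ (u <= Z)%MS ->
  exists2 w : 'rV_d, (w <= perp Z)%MS & hform w w = 0 /\ hform u w = 1.
Proof.
move=> ZZ uZ uu nuZ.
have /exists_vec[w0 w0Z nw0] : ~~ (perp Z <= perp u)%MS by rewrite (perp_subP sK).
rewrite hform_perp in nw0.
pose w1 := (hform w0 u)^-1 *: w0.
have uw1 : hform w1 u = 1 by rewrite hformZl mulVf.
have wu1 : hform u w1 = 1 by rewrite hformC // uw1 rmorph1.
have w1Z : (w1 <= perp Z)%MS by rewrite scalemx_sub.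
have sw1 : s (hform w1 w1) = hform w1 w1 by rewrite -hformC.
clearbody w1.
have [c tr_c] := exists_trace1.
pose t := - c * hform w1 w1.
exists (w1 + t *: u); first by rewrite addmx_sub ?scalemx_sub.
split; last by rewrite !hformE uu wu1 mulr0 addr0.
have tt : t + s t = - hform w1 w1.
  by rewrite /t rmorphM rmorphN sw1 -mulrDl -opprD tr_c mulN1r.
rewrite !hformE uu wu1 uw1 !mulr0 !mulr1 addr0 -addrA [s t + t]addrC tt.
by rewrite subrr.
Qed.

(* Write [C i = A + u], [C' i = A + u'] with [A = C i.-1], and [z = u' - u].  For
   [i < m] the Eichler transformation along [z] and a partner of [u] maps [u] to
   [u']; for [i = m] the transvection along [z] does, once [u'] is rescaled so that
   [z] is isotropic. *)
Lemma adjacent_conj C C' i : isflag C -> isflag C' -> (0 < i <= m)%N ->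
  adjacent i C C' ->
  exists2 g : gT, g \in SUs & forall k, (k <= m)%N -> (C k *m GLval g :=: C' k)%MS.
Proof.
move=> fC fC' i0 adj; have [rC CS Cm] := fC; have [rC' CS' Cm'] := fC'.
have im : (i <= m)%N by lia.
have i1m : (i.-1 <= m)%N by lia.
have i1 : (i.-1 < m)%N by lia.
have i1i : i.-1.+1 = i by lia.
have ni1 : i.-1 != i by lia.
have lt_i1 k : (k <= i.-1)%N = (k < i)%N by lia.
pose A := C i.-1.
have AC : (A <= C i)%MS by have := CS _ i1; rewrite i1i.
have eA : (A :=: C' i.-1)%MS by apply: adj; lia.
have AC' : (A <= C' i)%MS by rewrite eA; have := CS' _ i1; rewrite i1i.
have [eCC|nCC] := boolP (C i <= C' i)%MS.
  exists 1%g; first exact: SUs1.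
  move=> k km; rewrite GL_1E mulmx1; have [->|nk] := eqVneq k i; last exact: adj.
  by apply: eqmx_of_sub; rewrite ?rC ?rC'.
have rA : \rank A = i.-1 by rewrite rC.
have [u uC nuC'] := exists_vec nCC.
have nuA : ~~ (u <= A)%MS by apply: contra nuC' => /submx_trans; apply.
have /exists_vec[u' u'C' nu'C] : ~~ (C' i <= C i)%MS.
  apply: contra nCC => h; rewrite (eqmx_of_sub h) ?submx_refl //.
  by rewrite rC ?rC'.
have nu'A : ~~ (u' <= A)%MS by apply: contra nu'C => /submx_trans; apply.
have eC : (A + u :=: C i)%MS by apply: adds_vec_eq; rewrite ?rC // i1i.
have eC' : (A + u' :=: C' i)%MS by apply: adds_vec_eq; rewrite ?rC' ?rA ?i1i.
suff [g gG [ug stab]] : exists2 g : gT, g \in SUs & (u *m GLval g <= C' i)%MS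
    /\ forall k (v : 'rV_d), (k <= m)%N -> k != i -> (v <= C k)%MS -> (v *m GLval g <= C k)%MS.
  have {}stab k : (k <= m)%N -> k != i -> (C k *m GLval g <= C k)%MS.
    by move=> km ki; apply/row_subP=> j; rewrite row_mul stab ?row_sub.
  exists g => // k km; apply: eqmx_of_sub; last by rewrite rankGL rC ?rC'.
  have [->|nk] := eqVneq k i; last by rewrite -(adj k) // stab.
  rewrite -(eqmxMr (GLval g) eC) addsmxMr addsmx_sub ug andbT (submx_trans _ AC') //.
  exact: stab.
have uP k v : (k <= i.-1)%N -> (v <= C k)%MS -> (hform v u = 0) * (hform v u' = 0).
  rewrite lt_i1 => ki vC; have km := leq_trans (ltnW ki) im.
  have vC' : (v <= C' k)%MS by rewrite -(adj k) // neq_ltn ki.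
  split; first by apply: (@hform_sub _ _ _ sK _ _ (C k) (C i)); rewrite ?flag_perp.
  by apply: (@hform_sub _ _ _ sK _ _ (C' k) (C' i)); rewrite ?flag_perp.
have uu : hform u u = 0.
  by apply: (@hform_sub _ _ _ sK _ _ (C i) (C i)); rewrite ?flag_perp.
have uu' : hform u' u' = 0.
  by apply: (@hform_sub _ _ _ sK _ _ (C' i) (C' i)); rewrite ?flag_perp.
have [lim|gim] := ltnP i m.
  have uB : (u <= C i.+1)%MS by rewrite (submx_trans uC) ?CS.
  have u'B : (u' <= C i.+1)%MS.
    by rewrite (adj i.+1) ?(submx_trans u'C') ?CS' // neq_ltn ltnSn orbT.
  have AB : (A <= C i.+1)%MS by rewrite (submx_trans AC) ?CS.
  pose z := u' - u.
  have zB : (z <= C i.+1)%MS by rewrite addmx_sub ?eqmx_opp.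
  have AzB : (A + z <= C i.+1)%MS by rewrite addsmx_sub AB.
  have BB : (C i.+1 <= perp (C i.+1))%MS by rewrite flag_perp.
  have [||||w wZ [ww uw]] := @exists_eichler_partner _ (A + z)%MS u.
  - by rewrite (submx_trans AzB) // (submx_trans BB) // perpS.
  - by rewrite (submx_trans uB) // (submx_trans BB) // perpS.
  - by [].
  (* Otherwise C i + u', of dimension i+1, would lie in A + z, of dimension at most i. *)
  - apply/negP=> uAz.
    have h : (C i + u' <= A + z)%MS.
      rewrite addsmx_sub -eC addsmx_sub addsmxSl uAz /= -[u'](subrK u).
      by rewrite addmx_sub // addsmxSr.
    move/mxrankS: h; rewrite rank_adds_vec // rC // leqNgt ltnS => /negP; apply.
    rewrite -[X in (_ <= X)%N]i1i -rA.
    exact: rank_adds_vec_le.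
  have zz : hform z z = 0 by apply: (hform_sub sK BB).
  have zw : hform z w = 0.
    by rewrite hformC // (@hform_sub _ _ _ sK _ _ _ (A + z)%MS _ _ wZ) ?rmorph0 // addsmxSr.
  (* The map v |-> v - (v, z) w + (v, w) z sends u to u + z = u', since (u, z) = 0 and (u, w) =
     1. *)
  have [g gG gE] := exists_eichler sK pF (-1) zz ww zw.
  exists g => //; split=> [|k v km ki vk].
    rewrite gE uw (hform_sub sK BB uB zB) mulr0 scale0r addr0 rmorphN1 mulr1.
    by rewrite scaleN1r opprK addrC subrK.
  have [lki|lik] := ltnP k i.
    have ki1 : (k <= i.-1)%N by rewrite lt_i1.
    have vA : (v <= A)%MS by rewrite (submx_trans vk) // (flagS fC) // ki1.
    have vw : hform v w = 0.
      rewrite hformC // (@hform_sub _ _ _ sK _ _ _ (A + z)%MS _ _ wZ) ?rmorph0 //.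
      by rewrite (submx_trans vA) ?addsmxSl.
    rewrite gE vw hformDr hformNr !(uP k v ki1 vk) subrr !mulr0 !scale0r.
    by rewrite addr0 subr0.
  have zk : (z <= C k)%MS.
    by rewrite (submx_trans zB) // (flagS fC) // km andbT ltn_neqAle eq_sym ki.
  rewrite gE (@hform_sub _ _ _ sK _ _ (C k) (C k)) ?flag_perp //.
  by rewrite mulr0 scale0r addr0 addmx_sub // eqmx_opp scalemx_sub.
have eim : i = m by apply/eqP; rewrite eqn_leq im.
(* Otherwise u' would be orthogonal to the maximal isotropic C m, hence lie in it. *)
have nuu' : hform u u' != 0.
  apply/eqP=> h; move: nu'C; rewrite eim -(flag_max fC) -eim => /negP; apply.
  rewrite perp_sym // -eC addsmx_sub; apply/andP; split; last by rewrite hform_perp h.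
  apply/perpP => // v w vA wu'; have /sub_rVP[c ->] := wu'.
  by rewrite hformZr (uP i.-1 v _ vA).2 ?mulr0.
have [a na] := s_nontriv.
have nas : a - s a != 0 by rewrite subr_eq0 eq_sym.
(* With this scaling (u, u1) = 1 / (a - s a) has trace zero, so z = u1 - u is isotropic, and the
   transvection v |-> v + (a - s a)(v, z) z sends u to u + z = u1. *)
pose c := s ((a - s a)^-1 / hform u u').
pose u1 := c *: u'.
have uu1 : hform u u1 = (a - s a)^-1 by rewrite hformZr sK divfK.
have u1u : hform u1 u = - (a - s a)^-1.
  by rewrite hformC // uu1 fmorphV rmorphB sK -[s a - a]opprB invrN.
have u1u1 : hform u1 u1 = 0 by rewrite hformZr hformZl uu' !mulr0.
pose z := u1 - u.
have zz : hform z z = 0.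
  by rewrite hformDl !hformDr !hformNl !hformNr u1u1 u1u uu1 uu; ring.
have [g gG gE] := exists_eichler sK pF a zz zz zz.
have {}gE (v : 'rV_d) : v *m GLval g = v + ((a - s a) * hform v z) *: z.
  by rewrite gE mulrBl scalerBl addrA.
exists g => //; split=> [|k v km ki vk].
  rewrite gE hformDr hformNr uu uu1 subr0 mulfV // scale1r addrC subrK.
  by rewrite scalemx_sub.
have ki1 : (k <= i.-1)%N by rewrite lt_i1 ltn_neqAle ki eim.
rewrite gE hformDr hformNr hformZr !(uP k v ki1 vk) mulr0 subr0 mulr0 scale0r.
by rewrite addr0.
Qed.

Lemma SUs_flag_trans C C' : (0 < m)%N -> isflag C -> isflag C' ->
  exists2 g : gT, g \in SUs & forall k, (k <= m)%N -> (C k *m GLval g :=: C' k)%MS.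
Proof.
move=> m0 fC fC'.
apply: (@flag_connected (fun D => exists2 g : gT, g \in SUs &
   forall k, (k <= m)%N -> (C k *m GLval g :=: D k)%MS) _ C) => //.
  move=> D D' i fD fD' im adj [g gG gD].
  have [h hG hD] := adjacent_conj fD fD' im adj.
  exists (g * h)%g; first exact: SUsM.
  by move=> k km; rewrite GL_ME mulmxA; apply: eqmx_trans (hD k km); apply: eqmxMr; apply: gD.
by exists 1%g => [|k _]; [exact: SUs1|rewrite GL_1E mulmx1].
Qed.

End Flags.

(** * Subnormal p-subgroups *)

Section SubnormalPGroups.
Variables (gT : finGroupType) (p : nat).
Implicit Types G H K U : {group gT}.

(** Induction on the order of G: the p-core of a normal subgroup K is characteristic in K, so it is
    a normal p-subgroup of G. *)
Lemma subnormal_pcore G H : p.-group H -> H <|<| G -> H \subset 'O_p(G).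
Proof.
move=> pH; elim: {G}_.+1 {-2}G (ltnSn #|G|) => // k IH G leGk sHG.
have [<-|[K [sHK nKG pKG]]] := subnormalEr sHG; first by rewrite pcore_pgroup_id.
apply: subset_trans (IH K _ sHK) _.
  by rewrite -ltnS (leq_trans _ leGk) // ltnS proper_card.
by rewrite pcore_max ?pcore_pgroup // (char_normal_trans _ nKG) ?pcore_char.
Qed.

Lemma subnormal_in_normal_pgroup G H U :
  p.-group U -> U <| G -> H \subset U -> H <|<| G.
Proof.
move=> pU nUG sHU; apply: subnormal_trans (normal_subnormal nUG).
by apply: nilpotent_subnormal sHU; apply: pgroup_nil pU.
Qed.

Lemma pgroup_of_elements G : prime p ->
  (forall g, g \in G -> exists j, g ^+ (p ^ j) = 1) -> p.-group G.
Proof.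
move=> p_pr h; apply/pgroupP=> r r_pr /(Cauchy r_pr)[g gG or].
have [j gj] := h g gG; have : #[g] %| (p ^ j)%N by rewrite order_dvdn gj.
by rewrite or Euclid_dvdX // dvdn_prime2 // => /andP[].
Qed.

End SubnormalPGroups.

(** * Stabilisers of chains and their unipotent radicals *)

Section Chains.
Local Open Scope ring_scope.
Variables (F : finFieldType) (s : {rmorphism F -> F}) (n p : nat).
Hypothesis sK : involutive s.
Hypothesis pF : p \in [pchar F].
Local Notation d := n.-1.+1.
Local Notation hform := (@hform F s n).
Local Notation perp := (@perp F s n _).
Local Notation gT := {'GL_n[F]}.
Local Notation SUs := (SUs s n).
Implicit Types C : nat -> 'M[F]_d.

Lemma GL_unipotent_exp (g : gT) k : (GLval g - 1%:M) ^+ k = 0 ->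
  exists j, (g ^+ (p ^ j) = 1)%g.
Proof.
move=> /(unipotent_exp (pchar_mx n pF))[j]; rewrite addrC subrK => gj.
exists j; apply: val_inj; rewrite -[LHS]/(GLval _) -[RHS]gj.
elim: (p ^ j)%N => [|l IH]; first by rewrite expg0 expr0.
by rewrite expgS exprS -IH.
Qed.

Lemma stable_GLV (g : gT) k (A : 'M[F]_(k, d)) :
  (A *m GLval g <= A)%MS -> (A *m GLval g^-1%g <= A)%MS.
Proof.
move=> h; rewrite -(submxGL g) mulGLKV.
by rewrite (eqmx_of_sub h) ?rankGL.
Qed.

Lemma stable_perp (g : gT) k (A : 'M[F]_(k, d)) : g \in SUs ->
  (A *m GLval g <= A)%MS -> (perp A *m GLval g <= perp A)%MS.
Proof.
move=> gG /stable_GLV h; rewrite -(perp_mulGL A gG).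
by rewrite perpS // -(submxGL g^-1%g) mulGLK.
Qed.

(** Duality for one step of a filtration. For u in [perp A] and w in B, both u g and w (g - 1) lie
    in orthogonal spaces, so (u g, w) = (u g, w g) = (u, w). *)
Lemma perp_step (g : gT) k l (A : 'M[F]_(k, d)) (B : 'M[F]_(l, d)) : g \in SUs ->
  (A *m GLval g <= A)%MS -> (B *m (GLval g - 1%:M) <= A)%MS ->
  (perp A *m (GLval g - 1%:M) <= perp B)%MS.
Proof.
move=> gG Ag Bg; apply/perpP => // u w /submxP[a ->] wB; rewrite mulmxA.
set v := a *m perp A; have vA : (v <= perp A)%MS by rewrite submxMl.
clearbody v; have vgA : (v *m GLval g <= perp A)%MS.
  by rewrite (submx_trans _ (stable_perp gG Ag)) // submxMr.
have wA : (w *m (GLval g - 1%:M) <= A)%MS by rewrite (submx_trans _ Bg) // submxMr.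
have := @hform_sub _ _ _ sK _ _ (perp A) A _ _ (submx_refl _) vgA wA.
rewrite !mulmxBr !mulmx1 hformDr hformNr SUs_formE // => /eqP; rewrite subr_eq0.
by rewrite hformDl hformNl => /eqP ->; rewrite subrr.
Qed.

Section UnipotentRadical.
Variables (C : nat -> 'M[F]_d) (r : nat).
Hypothesis C0 : C 0%N = 0.

(* For a chain [C] of isotropic subspaces, [chain_stab] is a parabolic subgroup and
   [chain_radical] its unipotent radical. *)
Definition chain_stab : {set gT} :=
  [set h in SUs | [forall k : 'I_r.+1, (C k *m GLval h <= C k)%MS]].

Definition chain_radical : {set gT} :=
  [set h in chain_stab |
     [forall k : 'I_r, (C k.+1 *m (GLval h - 1%:M) <= C k)%MS]
     && (perp (C r) *m (GLval h - 1%:M) <= C r)%MS].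

Lemma chain_stabP h :
  reflect (h \in SUs /\ forall k, (k <= r)%N -> (C k *m GLval h <= C k)%MS)
          (h \in chain_stab).
Proof.
rewrite [X in reflect _ X]inE; apply: (iffP andP) => [[hG /forallP hC]|[hG hC]]; split=> //.
  by move=> k kr; apply: (hC (Ordinal (kr : (k < r.+1)%N))).
by apply/forallP=> k; apply: hC; rewrite -ltnS.
Qed.

Lemma chain_radicalP h :
  reflect [/\ h \in chain_stab,
              forall k, (k < r)%N -> (C k.+1 *m (GLval h - 1%:M) <= C k)%MS &
              (perp (C r) *m (GLval h - 1%:M) <= C r)%MS]
          (h \in chain_radical).
Proof.
rewrite [X in reflect _ X]inE; apply: (iffP and3P) => [[hS /forallP hC hr]|[hS hC hr]]; split=> //.
  by move=> k kr; apply: (hC (Ordinal kr)).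
by apply/forallP=> k; apply: hC.
Qed.

Lemma chain_stab_group_set : group_set chain_stab.
Proof.
apply/group_setP; split=> [|g h /chain_stabP[gG gC] /chain_stabP[hG hC]].
  by apply/chain_stabP; split=> [|k _]; rewrite ?group1 // GL_1E mulmx1.
apply/chain_stabP; split=> [|k kr]; first by rewrite groupM.
by rewrite GL_ME mulmxA (submx_trans _ (hC k kr)) // submxMr // gC.
Qed.
Canonical chain_stab_group := group chain_stab_group_set.

Lemma GLM_sub1 (g h : gT) k (A : 'M[F]_(k, d)) :
  A *m (GLval (g * h)%g - 1%:M)
  = A *m (GLval g - 1%:M) *m GLval h + A *m (GLval h - 1%:M).
Proof.
by rewrite GL_MxE !mulmxBr mulmxBl !mulmx1 !mulmxA addrA subrK.
Qed.

Lemma chain_stab_perp h : h \in chain_stab ->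
  (perp (C r) *m GLval h <= perp (C r))%MS.
Proof. by case/chain_stabP=> hG hC; rewrite stable_perp ?hC. Qed.

Lemma chain_radical_group_set : group_set chain_radical.
Proof.
apply/group_setP; split=> [|g h].
  apply/chain_radicalP; rewrite group1 GL_1E subrr.
  by split=> // [k _|]; rewrite mulmx0 sub0mx.
move=> /chain_radicalP[gS gC gr] /chain_radicalP[hS hC hr].
have [hG hK] := chain_stabP _ hS.
apply/chain_radicalP; split=> [|k kr|]; first by rewrite groupM.
  rewrite GLM_sub1 addmx_sub ?hC // (submx_trans _ (hK k (ltnW kr))) //.
  by rewrite submxMr ?gC.
by rewrite GLM_sub1 addmx_sub // (submx_trans _ (hK r (leqnn r))) // submxMr.
Qed.
Canonical chain_radical_group := group chain_radical_group_set.

Lemma chain_radical_normal : (chain_radical <| chain_stab)%g.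
Proof.
apply/andP; split; first by apply/subsetP=> h /chain_radicalP[].
apply/subsetP=> k kS; rewrite inE; apply/subsetP=> _ /imsetP[h /chain_radicalP[hS hC hr] ->].
have kVS : k^-1%g \in chain_stab by rewrite groupV.
have [kG kC] := chain_stabP _ kS; have [_ kVC] := chain_stabP _ kVS.
have conjE l (A : 'M[F]_(l, d)) : A *m (GLval (h ^ k)%g - 1%:M)
    = A *m GLval k^-1%g *m (GLval h - 1%:M) *m GLval k.
  rewrite !mulmxBr mulmxBl !mulmx1 mulGLKV conjgE.
  by rewrite !GL_MxE !mulmxA.
apply/chain_radicalP; split=> [|j jr|]; first by rewrite groupJ.
  rewrite conjE (submx_trans _ (kC j (ltnW jr))) // submxMr //.
  by rewrite (submx_trans _ (hC j jr)) // submxMr // kVC.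
rewrite conjE (submx_trans _ (kC r (leqnn r))) // submxMr //.
by rewrite (submx_trans _ hr) // submxMr // chain_stab_perp.
Qed.

(** The upper half of the filtration follows from the lower one by duality: N^r maps everything into
    [perp (C r)], one more N maps this into C r, and r further ones kill it. Hence N^(2r+1) = 0. *)
Lemma chain_radical_pgroup : (p.-group chain_radical)%g.
Proof.
apply: pgroup_of_elements (pcharf_prime pF) _ => h /chain_radicalP[hS hC hr].
have [hG hK] := chain_stabP _ hS; set N := GLval h - 1%:M in hC hr.
apply: (@GL_unipotent_exp _ (r + (1 + r))); rewrite -/N.
have down k : (k <= r)%N -> C k *m N ^+ k = 0.
  elim: k => [|k IH] kr; first by rewrite C0 mul0mx.
  rewrite exprS mulmxA; have /submxP[D ->] := hC k kr.
  by rewrite -mulmxA IH ?mulmx0 // ltnW.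
have up k : (k <= r)%N -> (N ^+ k <= perp (C k))%MS.
  elim: k => [|k IH] kr; first by rewrite perp_sym // C0 sub0mx.
  rewrite exprSr (submx_trans (submxMr N (IH (ltnW kr)))) //.
  by apply: perp_step => //; [apply/hK/ltnW|apply: hC].
rewrite exprD exprS; have /submxP[D eD] := up r (leqnn r); have /submxP[E eE] := hr.
have -> : N ^+ r * (N * N ^+ r) = D *m (perp (C r) *m N *m N ^+ r).
  by rewrite -(mulmxA (perp _)) (mulmxA D) -eD.
by rewrite eE -mulmxA down // !mulmx0.
Qed.

(** The radical meets <<g, x>> in a normal p-subgroup containing x, and every subgroup of a p-group
    is subnormal in it. *)
Lemma chain_stab_subnormalizer x g : x \in chain_radical -> g \in chain_stab ->
  g \in subnormalizer_set SUs <[x]>%g.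
Proof.
move=> xU gS; have xS : x \in chain_stab by case/chain_radicalP: xU.
have [gG _] := chain_stabP _ gS; rewrite inE gG /=.
pose H := <<g |: <[x]> >>%G; rewrite -/(gval H); have sHS : H \subset chain_stab.
  by rewrite gen_subG subUset sub1set gS cycle_subG.
apply: (@subnormal_in_normal_pgroup _ p _ _ (H :&: chain_radical)%G).
- exact: pgroupS (subsetIr _ _) chain_radical_pgroup.
- exact: normalGI sHS chain_radical_normal.
by rewrite subsetI sub_gen ?subsetUr //= cycle_subG.
Qed.

End UnipotentRadical.
End Chains.

(** * Flag transitivity from panels *)

Section Generation.
Local Open Scope ring_scope.
Variables (F : finFieldType) (s : {rmorphism F -> F}) (n m : nat).
Hypothesis sK : involutive s.
Local Notation d := n.-1.+1.
Hypothesis dm : d = (2 * m)%N.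
Local Notation hform := (@hform F s n).
Local Notation perp := (@perp F s n _).
Local Notation gT := {'GL_n[F]}.
Local Notation SUs := (SUs s n).
Local Notation isflag := (isflag s m).
Local Notation adjacent := (adjacent m).

Lemma rank_perpE k (A : 'M[F]_(k, d)) : \rank (perp A) = (2 * m - \rank A)%N.
Proof. by rewrite -(etrans (rank_perp s A) dm) addnK. Qed.

Lemma isflag_mulGL C g : g \in SUs -> isflag C -> isflag (fun k => C k *m GLval g).
Proof.
move=> gG [rC CS Cm]; split=> [k km|k km|]; first by rewrite rankGL rC.
  by rewrite submxMr ?CS.
by rewrite SUs_perp.
Qed.

Section Orbit.
Variable M : {group gT}.
Hypothesis sMG : (M \subset SUs)%g.

Definition panel_transitive i C := forall C', isflag C' -> adjacent i C C' ->
  exists2 g : gT, g \in M & forall k, (k <= m)%N -> (C k *m GLval g :=: C' k)%MS.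

(** The gallery argument needs transitivity on the panels of every flag in the orbit; by conjugation
    one flag is enough. *)
Lemma panel_transitive_conj i C D h : h \in M ->
  (forall k, (k <= m)%N -> (C k *m GLval h :=: D k)%MS) ->
  panel_transitive i C -> panel_transitive i D.
Proof.
move=> hM CD trC D' fD' adjD.
have [||g gM gC] := trC (fun k => D' k *m GLval h^-1%g).
- by apply: isflag_mulGL => //; apply: SUsV; apply: (subsetP sMG).
- move=> k km ki; rewrite -[C k](mulGLK h); apply: eqmxMr.
  by apply: eqmx_trans (CD k km) _; apply: adjD.
exists (h^-1 * g * h)%g; first exact: mem_GLM (mem_GLM (mem_GLV hM) gM) hM.
move=> k km; rewrite !GL_ME !mulmxA -[D' k](mulGLKV h); apply: eqmxMr.
apply: eqmx_trans _ (gC k km); apply: eqmxMr.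
by rewrite -[C k](mulGLK h); apply: eqmxMr; apply/eqmx_sym/CD.
Qed.

(** Frattini argument: connectivity makes M transitive on all flags, so any g agrees on C with some
    h in M, and g h^-1 stabilises C. *)
Lemma flag_transitive_eq_SUs C : (0 < m)%N -> isflag C ->
  (forall i, (0 < i <= m)%N -> panel_transitive i C) ->
  (forall g, g \in SUs -> (forall k, (k <= m)%N -> (C k *m GLval g <= C k)%MS) -> g \in M) ->
  M :=: SUs.
Proof.
move=> m0 fC trC stC; apply/eqP; rewrite eqEsubset sMG /=.
pose P (D : nat -> 'M[F]_d) := exists2 g : gT, g \in M & forall k, (k <= m)%N -> (C k *m GLval g :=: D k)%MS.
have PD D : isflag D -> P D.
  move=> fD; apply: (flag_connected sK dm (P := P) _ m0 fC fD) => [{fD}D D' i fD fD' im adj|].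
    move=> [g gM gD]; have [h hM hD] := panel_transitive_conj gM gD (trC i im) fD' adj.
    exists (g * h)%g; first exact: mem_GLM.
    move=> k km; rewrite GL_ME mulmxA; apply: eqmx_trans _ (hD k km).
    by apply: eqmxMr; apply: gD.
  by exists 1%g; rewrite ?group1 // => k _; rewrite GL_1E mulmx1.
apply/subsetP=> g gG; have [h hM hD] := PD _ (isflag_mulGL gG fC).
have hG := subsetP sMG _ hM.
have ghG : (g * h^-1)%g \in SUs := SUsM gG (SUsV hG).
have ghM : (g * h^-1)%g \in M.
  apply: (stC _ ghG) => k km.
  by rewrite GL_ME mulmxA -[X in (_ <= X)%MS](mulGLK h) submxMr // hD.
by have := groupM ghM hM; rewrite mulgKV.
Qed.

End Orbit.

(** * Isotropic vectors adapted to a unipotent element *)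

Hypothesis norm_surj : forall c, s c = c -> exists t, t * s t = c.
Variable x : gT.
Hypothesis xG : x \in SUs.
Let N : 'M[F]_d := GLval x - 1%:M.

(* If [N] is nonzero on [perp B / B], the last nonzero vector of a sequence
   [v *m N ^+ k] is isotropic, being both in the image and in the kernel of [N]. *)
Lemma exists_fixed_isotropic (B : 'M[F]_d) l :
  N ^+ l = 0 -> (B <= perp B)%MS -> (B *m N <= B)%MS -> (\rank B < m)%N ->
  exists2 y : 'rV_d, (y <= perp B)%MS &
    [/\ ~~ (y <= B)%MS, (y *m N <= B)%MS & hform y y = 0].
Proof.
move=> Nl BB BN rB; have Bx : (B *m GLval x <= B)%MS.
  by rewrite -[GLval x](subrK 1%:M) mulmxDr mulmx1 addmx_sub.
(* If N vanishes on perp B / B, which has dimension at least 2, any isotropic vector of perp B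
   outside B will do. *)
have [sN|/exists_vec[u0 u0B nu0]] := boolP (perp B *m N <= B)%MS.
  have [|y yB /andP[nyB /eqP yy]] := exists_isotropic_rel sK norm_surj BB.
    by rewrite rank_perpE; lia.
  by exists y => //; split=> //; rewrite (submx_trans _ sN) // submxMr.
have /submxP[w ew] := u0B; pose v := w *m perp B.
have vE : v *m N = u0 by rewrite ew mulmxA.
have vB : (v <= perp B)%MS by rewrite submxMl.
pose P k := (v *m N ^+ k.+1 <= B)%MS.
have exP : exists k, P k by exists l; rewrite /P exprS Nl mulr0 mulmx0 sub0mx.
have := ex_minnP exP; case=> -[|k] Pk kmin.
  by move: Pk; rewrite /P expr1 vE (negPf nu0).
have nPk : ~~ P k by apply/negP=> /kmin; rewrite ltnn.
pose u := v *m N ^+ k; have perpN : (perp B *m N <= perp B)%MS.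
  apply: perp_step => //.
have uB : (u <= perp B)%MS.
  rewrite /u; elim: (k) => [|j IH]; first by rewrite expr0 mulmx1.
  by rewrite exprSr mulmxA (submx_trans _ perpN) // submxMr.
have uNE : u *m N = v *m N ^+ k.+1 by rewrite exprSr mulmxA.
have uNNE : u *m N *m N = v *m N ^+ k.+2 by rewrite uNE (exprSr N k.+1) mulmxA.
exists (u *m N); first by rewrite (submx_trans _ perpN) // submxMr.
split; [by rewrite uNE | by rewrite uNNE |].
have uxB : (u *m GLval x <= perp B)%MS.
  by rewrite (submx_trans _ (stable_perp sK xG Bx)) // submxMr.
(* As u N N lies in B and u x in perp B, 0 = (u x, u N x) - (u x, u N) = (u, u N) - (u x, u N) = -(u
   N, u N). *)
have := @hform_sub _ _ _ sK _ _ _ B _ (u *m N *m N) (submx_refl _) uxB.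
rewrite uNNE => /(_ Pk); rewrite -uNNE.
have -> : u *m N *m N = u *m N *m GLval x - u *m N by rewrite mulmxBr mulmx1.
rewrite hformDr hformNr SUs_formE // => /eqP; rewrite subr_eq0 => /eqP e.
by rewrite [X in hform X _]mulmxBr mulmx1 hformDl hformNl e subrr.
Qed.

(* The form [(v *m N, w)] is skew-hermitian on the plane [perp A / B]; for an
   isotropic vector [w] of it one takes [C = B :&: perp w]. *)
Lemma exists_middle (A B : 'M[F]_d) : (0 < m)%N ->
  (A <= B)%MS -> (B <= perp B)%MS -> (B *m N <= A)%MS -> \rank B = m -> (\rank A).+2 = m ->
  exists2 C : 'M_d, (A <= C)%MS /\ (C <= B)%MS &
    \rank C = m.-1 /\ (perp C *m N <= C)%MS.
Proof.
move=> m0 AB BB BN rB rA.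
have AN : (A *m N <= A)%MS by rewrite (submx_trans _ BN) // submxMr.
have Ax : (A *m GLval x <= A)%MS.
  by rewrite -[GLval x](subrK 1%:M) mulmxDr mulmx1 addmx_sub.
have eB : (perp B :=: B)%MS.
  by apply: eqmx_sym; apply: eqmx_of_sub => //; rewrite rank_perpE rB; lia.
have BA : (B <= perp A)%MS by rewrite (submx_trans BB) // perpS.
have ANB : (perp A *m N <= B)%MS by rewrite -eB; apply: perp_step.
have rpA : \rank (perp A) = m.+2 by rewrite rank_perpE; clear -rA; lia.
pose b (v w : 'rV_d) := hform (v *m N) w.
have bNN v w : (v <= perp A)%MS -> (w <= perp A)%MS -> hform (v *m N) (w *m N) = 0.
  by move=> vA wA; apply: (hform_sub sK BB); rewrite (submx_trans _ ANB) // submxMr.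
(* Expand (w x, v x) = (w, v) with x = 1 + N, where (w N, v N) = 0. *)
have bC v w : (v <= perp A)%MS -> (w <= perp A)%MS -> b w v = - s (b v w).
  move=> vA wA; rewrite /b -hformC //; have := SUs_formE w v xG.
  have xE u : u *m GLval x = u *m N + u by rewrite mulmxBr mulmx1 subrK.
  rewrite !xE !hformDl !hformDr bNN // add0r addrA.
  by move/(canRL (addrK _)); rewrite subrr => /eqP; rewrite addr_eq0 => /eqP.
have [w wA [nwB bww]] : exists2 w : 'rV_d, (w <= perp A)%MS & ~~ (w <= B)%MS /\ b w w = 0.
  have /exists_vec[w1 w1A nw1] : ~~ (perp A <= B)%MS.
    by apply/negP=> /mxrankS; rewrite rpA rB; clear; lia.
  have /exists_vec[w2 w2A nw2] : ~~ (perp A <= B + w1)%MS.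
    by apply/negP=> /mxrankS; rewrite rpA rank_adds_vec // rB ltnn.
  have [b11|nb] := eqVneq (b w1 w1) 0; first by exists w1.
  pose c := b w2 w1 / b w1 w1; pose w3 := w2 - c *: w1.
  have bDl v w u : b (v + w) u = b v u + b w u by rewrite /b mulmxDl hformDl.
  have bDr v w u : b u (v + w) = b u v + b u w by rewrite /b hformDr.
  have bZl a v u : b (a *: v) u = a * b v u by rewrite /b -scalemxAl hformZl.
  have bZr a v u : b u (a *: v) = s a * b u v by rewrite /b hformZr.
  have w3A : (w3 <= perp A)%MS by rewrite addmx_sub // eqmx_opp scalemx_sub.
  have b31 : b w3 w1 = 0.
    by rewrite bDl -scaleNr bZl mulNr /c divfK // subrr.
  have b13 : b w1 w3 = 0 by rewrite bC // b31 rmorph0 oppr0.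
  have nw3 : ~~ (w3 <= B + w1)%MS.
    apply: contra nw2 => h; rewrite -[w2](subrK (c *: w1)) addmx_sub //.
    by rewrite scalemx_sub ?addsmxSr.
  have sb v : (v <= perp A)%MS -> s (b v v) = - b v v.
    by move=> vA; rewrite [in RHS](bC v v vA vA) opprK.
  clearbody w3.
  (* Both values of b are negated by [s], so their quotient is fixed by [s], hence a norm. *)
  have [|t tE] := norm_surj (c := - b w3 w3 / b w1 w1).
    by rewrite rmorphM rmorphN fmorphV !sb // opprK invrN mulrN mulNr.
  exists (w3 + t *: w1); first by rewrite addmx_sub ?scalemx_sub.
  split.
    apply: contra nw3 => h; rewrite -[w3](addrK (t *: w1)) addmx_sub //.
      by rewrite (submx_trans h) ?addsmxSl.
    by rewrite eqmx_opp scalemx_sub ?addsmxSr.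
  rewrite bDl !bDr !bZl !bZr b13 b31 !mulr0 addr0 add0r.
  by rewrite mulrA tE divfK // subrr.
pose C := (B :&: perp w)%MS; have CB : (C <= B)%MS := capmxSl _ _.
have wC : (w <= perp C)%MS by rewrite perp_sym // capmxSr.
have AC : (A <= C)%MS by rewrite sub_capmx AB perp_sym.
have rC : \rank C = m.-1.
  have nBw : ~~ (B <= perp w)%MS by rewrite perp_sym // eB.
  have h1 : (\rank C < \rank B)%N.
    rewrite ltn_neqAle mxrankS // andbT (mxrank_leqif_sup CB).2.
    by rewrite sub_capmx submx_refl.
  have := mxrank_sum_cap B (perp w); have := rank_perp s w; have := rank_leq_row w.
  have := rank_leq_col (B + perp w)%MS; move: h1; rewrite rB -/C.
  generalize (\rank C) (\rank (perp w)) (\rank w) (\rank (B + perp w)%MS).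
  by clear -m0; lia.
exists C => //; split=> //.
(* N maps B into A <= C; it maps w into B and, because b w w = 0, into the orthogonal of w, hence
   into C. *)
have eC : (B + w :=: perp C)%MS.
  apply: adds_vec_eq => //; first by rewrite (submx_trans BB) // perpS.
  by rewrite rank_perpE rC rB; clear -m0; lia.
rewrite -(eqmxMr N eC) addsmxMr addsmx_sub (submx_trans BN) //= sub_capmx.
by rewrite (submx_trans _ ANB) ?submxMr //= hform_perp; apply/eqP.
Qed.

End Generation.

(** * Sub(x) = G when an isotropic plane is fixed *)

Section Tower.
Local Open Scope ring_scope.
Variables (F : finFieldType) (s : {rmorphism F -> F}) (n m p : nat).
Hypothesis sK : involutive s.
Hypothesis pF : p \in [pchar F].
Hypothesis s_nontriv : exists a, s a != a.
Hypothesis norm_surj : forall c, s c = c -> exists t, t * s t = c.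
Local Notation d := n.-1.+1.
Hypothesis dm : d = (2 * m)%N.
Local Notation hform := (@hform F s n).
Local Notation perp := (@perp F s n _).
Local Notation gT := {'GL_n[F]}.
Local Notation SUs := (SUs s n).
Local Notation isflag := (isflag s m).
Local Notation adjacent := (adjacent m).
Variable x : gT.
Hypothesis xG : x \in SUs.
Local Notation N := (GLval x - 1%:M).

(* [x] acts trivially on [B j.+2 / A j], so it fixes every flag which differs only
   in dimension [j.+1] from [A 0, ..., A j, B j.+1, ..., B m]. *)
Definition tower k (A B : nat -> 'M[F]_d) :=
  [/\ forall j, (j.+2 <= k)%N ->
        [/\ \rank (A j) = j, (A j <= B j.+1)%MS & (B j.+2 *m N <= A j)%MS],
      forall j, (j.+3 <= k)%N -> (A j <= A j.+1)%MS,
      forall j, (0 < j <= k)%N -> \rank (B j) = j,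
      forall j, (0 < j < k)%N -> (B j <= B j.+1)%MS &
      (B k <= perp (B k))%MS].

Lemma tower_base (L : 'M[F]_d) : \rank L = 2%N -> (L <= perp L)%MS -> L *m N = 0 ->
  exists A B, tower 2 A B.
Proof.
move=> rL LL LN; have /exists_vec[u uL nu] : ~~ (L <= (0 : 'M[F]_d))%MS.
  by apply/negP=> /mxrankS; rewrite rL mxrank0.
exists (fun _ => 0), (fun j => if j == 1%N then ((0 : 'M[F]_d) + u)%MS else L).
split=> //.
- by move=> [|[|j]] // _; rewrite mxrank0 sub0mx /= LN sub0mx.
- move=> [|[|[|j]]] // _; rewrite /= rank_adds_vec ?mxrank0 //.
- by move=> [|[|[|j]]] // _; rewrite /= addsmx_sub sub0mx.
Qed.

(** An isotropic y fixed modulo B (k+2) prolongs B. Since B (k+2) N <= A k, it is enough to prolong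
    A by one vector u with y N in A k + u: take y N itself, or any vector of B (k+2) outside A k if
    y N already lies in A k. *)
Lemma tower_step k l (A B : nat -> 'M[F]_d) : N ^+ l = 0 -> (k.+2 < m)%N ->
  tower k.+2 A B -> exists A' B', tower k.+3 A' B'.
Proof.
move=> Nl km [hA hAA rB hBB BB].
have [rAk AB BN] := hA k (leqnn _).
have rBk : \rank (B k.+2) = k.+2 by rewrite rB ?leqnn.
have AB2 : (A k <= B k.+2)%MS by rewrite (submx_trans AB) // hBB // leqnn.
have BBN : (B k.+2 *m N <= B k.+2)%MS by rewrite (submx_trans BN).
have [|y yB [nyB yN yy]] := exists_fixed_isotropic sK dm norm_surj xG Nl BB BBN.
  by rewrite rBk.
have [u uB [nuA yNu]] : exists2 u : 'rV_d, (u <= B k.+2)%MS &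
    ~~ (u <= A k)%MS /\ (y *m N <= A k + u)%MS.
  have [yA|nyA] := boolP (y *m N <= A k)%MS; last by exists (y *m N); rewrite ?addsmxSr.
  have /exists_vec[u uB nu] : ~~ (B k.+2 <= A k)%MS.
    by apply/negP=> /mxrankS; rewrite rBk rAk; clear; lia.
  by exists u => //; split=> //; rewrite (submx_trans yA) ?addsmxSl.
pose A' := upd A k.+1 (A k + u)%MS; pose B' := upd B k.+3 (B k.+2 + y)%MS.
have A'E j : (j <= k)%N -> A' j = A j by move=> jk; rewrite /A' /upd ltn_eqF.
have B'E j : (j <= k.+2)%N -> B' j = B j by move=> jk; rewrite /B' /upd ltn_eqF.
have A'k : A' k.+1 = (A k + u)%MS by rewrite /A' /upd eqxx.
have B'k : B' k.+3 = (B k.+2 + y)%MS by rewrite /B' /upd eqxx.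
clearbody A' B'; exists A', B'; split.
- move=> j; rewrite !ltnS leq_eqVlt => /orP[/eqP ->|].
    rewrite A'k B'k B'E // rank_adds_vec // rAk; split=> //.
      by rewrite addsmx_sub AB2.
    by rewrite addsmxMr addsmx_sub yNu (submx_trans BN) ?addsmxSl.
  by rewrite ltnS => jk; rewrite A'E // (B'E j.+2) // (B'E j.+1 (leqW jk)); apply: hA.
- move=> j; rewrite !ltnS leq_eqVlt => /orP[/eqP ->|]; first by rewrite A'k A'E ?addsmxSl.
  by move=> jk; rewrite !A'E ?hAA // ltnW.
- move=> j /andP[j0]; rewrite leq_eqVlt => /orP[/eqP ->|].
    by rewrite B'k rank_adds_vec // rBk.
  by rewrite ltnS => jk; rewrite B'E // rB // j0.
- move=> j /andP[j0]; rewrite ltnS leq_eqVlt => /orP[/eqP ->|].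
    by rewrite B'k B'E ?addsmxSl.
  by move=> jk; rewrite !B'E ?hBB ?j0 // ltnW.
rewrite B'k; apply: isotropic_adds => //.
by rewrite hform_perp yy.
Qed.

Lemma exists_tower (L : 'M[F]_d) l k : N ^+ l = 0 -> (1 < m)%N ->
  \rank L = 2%N -> (L <= perp L)%MS -> L *m N = 0 -> (k.+2 <= m)%N ->
  exists A B, tower k.+2 A B.
Proof.
move=> Nl m1 rL LL LN; elim: k => [|k IH] km; first exact: tower_base rL LL LN.
by have [A [B tAB]] := IH (ltnW km); apply: tower_step Nl km tAB.
Qed.

Lemma SubG_full (L : 'M[F]_d) l : N ^+ l = 0 -> (1 < m)%N ->
  \rank L = 2%N -> (L <= perp L)%MS -> L *m N = 0 -> SubG SUs x = SUs.
Proof.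
move=> Nl m1 rL LL LN.
have [A0 [B [hA hAA rB hBB BB]]] : exists A B, tower m A B.
  by case: (m) m1 (@exists_tower L l) => [|[|k]] // _; apply.
have [k mE] : exists k, m = k.+2 by exists m.-2; lia.
have m0 : (0 < m)%N by lia.
have [|rAk AB BN] := hA k; first by rewrite mE.
have rBm : \rank (B m) = m by rewrite rB ?m0 /=.
have AB' : (A0 k <= B m)%MS by rewrite (submx_trans AB) // mE hBB // mE ltnSn.
rewrite -mE in BN.
have [|C [AC CB] [rC CN]] := exists_middle sK dm norm_surj xG m0 AB' BB BN rBm.
  by rewrite rAk mE.
(* The tower says nothing about its A in dimension m-1; the hyperplane C of B m fills this place. *)
pose A := upd A0 m.-1 C.
have AE j : (j.+2 <= m)%N -> A j = A0 j.
  by move=> jm; rewrite /A /upd ltn_eqF // -ltnS prednK.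
have Am : A m.-1 = C by rewrite /A /upd eqxx.
have rA j : (j < m)%N -> \rank (A j) = j.
  rewrite -{1}(prednK m0) ltnS leq_eqVlt => /orP[/eqP ->|jm]; first by rewrite Am.
  have jm2 : (j.+2 <= m)%N by rewrite -(prednK m0).
  by rewrite AE //; case: (hA j jm2).
have hAB j : (j < m)%N -> (A j <= B j.+1)%MS.
  rewrite -{1}(prednK m0) ltnS leq_eqVlt => /orP[/eqP ->|jm]; first by rewrite Am (prednK m0).
  have jm2 : (j.+2 <= m)%N by rewrite -(prednK m0).
  by rewrite AE //; case: (hA j jm2).
have hBN j : (j.+2 <= m)%N -> (B j.+2 *m N <= A j)%MS.
  by move=> jm; rewrite AE //; case: (hA j jm).
have AS j : (j.+1 < m)%N -> (A j <= A j.+1)%MS.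
  move=> jm; have [ej|nj] := eqVneq j.+2 m.
    by rewrite AE // (_ : j.+1 = m.-1) ?Am -?ej // (_ : j = k) //; move: ej; rewrite mE => -[].
  have jm3 : (j.+3 <= m)%N by rewrite ltn_neqAle nj.
  by rewrite !AE ?hAA.
have BNB j : (j.+1 < m)%N -> (B j.+2 *m N <= B j.+1)%MS.
  by move=> jm; rewrite (submx_trans (hBN _ jm)) // hAB // ltnW.
have ANA j : (j.+1 < m)%N -> (A j.+1 *m N <= A j)%MS.
  by move=> jm; rewrite (submx_trans (submxMr _ (hAB _ jm))) // hBN.
have eBm : (perp (B m) :=: B m)%MS.
  apply: eqmx_sym; apply: eqmx_of_sub => //; rewrite (rank_perpE s dm) rBm.
  by rewrite mul2n -addnn addnK.
have perpCN : (perp (A m.-1) *m N <= A m.-1)%MS by rewrite Am.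
have BmN : (B m *m N <= B m)%MS.
  by rewrite (submx_trans BN).
clearbody A.
(* This is the flag G_i. *)
pose fl i j := if (j <= i)%N then A j else B j.
have fl_flag i : (i < m)%N -> isflag (fl i).
  move=> im; split=> [j jm|j jm|]; rewrite /fl.
  - case: leqP => ji; first by rewrite rA // (leq_ltn_trans ji).
    by rewrite rB // jm (leq_ltn_trans (leq0n i)).
  - case: ltngtP => ji; first by rewrite AS // (leq_ltn_trans ji).
      by rewrite hBB // jm andbT (leq_ltn_trans (leq0n i)).
    by rewrite hAB.
  - by rewrite leqNgt im.
(* The entry of dimension i+1 is replaced by a repetition of A i: this chain encodes the panel, and
   its stabiliser does not see dimension i+1. *)
pose ch i j := if j == i.+1 then A i else fl i j.
have A0' : A 0%N = 0 by apply/eqP; rewrite -mxrank_eq0 rA.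
have Astab j : (j < m)%N -> (A j *m N <= A j)%MS.
  case: j => [|j] jm; first by rewrite A0' mul0mx sub0mx.
  by rewrite (submx_trans (ANA j jm)) // AS.
have ch0 i : ch i 0%N = 0 by rewrite /ch /= /fl leq0n A0'.
have stabx l' (X : 'M[F]_(l', d)) : (X *m N <= X)%MS -> (X *m GLval x <= X)%MS.
  by move=> XN; rewrite -[GLval x](subrK 1%:M) mulmxDr mulmx1 addmx_sub.
have x_rad i : (i < m)%N -> x \in chain_radical s (ch i) m.
  move=> im; have step j : (j < m)%N -> (ch i j.+1 *m N <= ch i j)%MS.
    move=> jm; rewrite /ch /fl eqSS; case: (ltngtP j i) => ji.
    - by rewrite ltn_eqF ?(ltnW ji) ?ANA ?(leq_ltn_trans ji) // ltnW.
    - case: eqP => [ej|/eqP nej]; first by rewrite ej hBN // -ej.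
      case: j jm ji {nej} => // j jm ji; exact: BNB.
    - by rewrite ji ltn_eqF ?Astab.
  (* For i = m-1 the chain ends with C, and this is the property for which C was chosen; otherwise
     it ends with B m, its own orthogonal. *)
  have last_step : (perp (ch i m) *m N <= ch i m)%MS.
    rewrite /ch /fl; case: eqP => [em|_].
      by move: perpCN; rewrite em.
    by rewrite leqNgt im /= (eqmxMr N eBm) BmN.
  apply/chain_radicalP; split=> //; apply/chain_stabP; split=> // j jm.
  case: j jm => [|j] jm; first by rewrite ch0 mul0mx sub0mx.
  apply: stabx; rewrite (submx_trans (step j jm)) //.
  rewrite /ch /fl eqSS; case: (ltngtP j i) => ji.
  - by rewrite ltn_eqF ?(ltnW ji) ?AS ?(leq_ltn_trans ji) // ltnW.
  - case: eqP => [ej|/eqP nej].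
      by rewrite ej (submx_trans (AS i _)) -?ej ?(ltnW jm)// hAB // ej.
    by rewrite hBB // jm andbT (leq_ltn_trans (leq0n i)).
  - by rewrite ji ltn_eqF.
pose M := <<subnormalizer_set SUs <[x]> >>%G.
have sMG : M \subset SUs.
  by rewrite (gen_subG _ (SUs_group s n)); apply/subsetP=> g; rewrite inE => /andP[].
have in_M i g : (i < m)%N -> g \in SUs ->
    (forall j, (j <= m)%N -> j != i.+1 -> (fl i j *m GLval g <= fl i j)%MS) -> g \in M.
  move=> im gG gfl; apply: mem_gen.
  apply: (chain_stab_subnormalizer sK pF (ch0 i) (x_rad i im)).
  apply/chain_stabP; split=> // j jm; rewrite /ch; case: eqP => [_|/eqP]; last exact: gfl.
  have -> : A i = fl i i by rewrite /fl leqnn.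
  by apply: gfl; rewrite ?(ltnW im) // neq_ltn ltnSn.
have panel i : (i < m)%N -> panel_transitive s m M i.+1 (fl i).
  move=> im C' fC' adj.
  have [g gG gC] := adjacent_conj sK dm pF s_nontriv (fl_flag i im) fC' (im : (0 < i.+1 <= m)%N) adj.
  exists g => //; apply: (in_M i) => // j jm ji.
  by rewrite gC // adj.
(* Consecutive G_i share a panel on which M is transitive, so M moves each G_i to G_0 and carries
   the transitivity on its panel along. *)
have conj i : (i < m)%N -> exists2 h, h \in M &
    forall k, (k <= m)%N -> (fl i k *m GLval h :=: fl 0%N k)%MS.
  elim: i => [|i IH] im.
    by exists 1%g => [|j _]; [exact: group1|rewrite GL_1E mulmx1].
  have [h hM hC] := IH (ltnW im).
  have [|g gM gC] := panel i (ltnW im) (fl i.+1) (fl_flag _ im).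
    move=> j jm ji; have -> : fl i.+1 j = fl i j; last by [].
    by rewrite /fl leq_eqVlt (negPf ji) ltnS.
  exists (g^-1 * h)%g; first exact: mem_GLM (mem_GLV gM) hM.
  move=> j jm; rewrite GL_ME mulmxA; apply: eqmx_trans _ (hC j jm); apply: eqmxMr.
  by rewrite -[fl i j](mulGLK g); apply/eqmxMr/eqmx_sym/gC.
apply: (flag_transitive_eq_SUs sK dm sMG m0 (fl_flag _ m0)) => [i /andP[i0 im]|g gG gC].
  case: i i0 im => // i _ im; have [h hM hC] := conj i im.
  by apply: panel_transitive_conj hM hC (panel i im).
by apply: (in_M 0%N) => // j jm _; apply: gC.
Qed.

End Tower.

(** * Nilpotent matrices and cyclic vectors *)

Section Nilpotent.
Local Open Scope ring_scope.
Variables (F : fieldType) (d' : nat).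
Local Notation d := d'.+1.
Variables (N : 'M[F]_d) (l : nat).
Hypothesis Nl : N ^+ l = 0.

Lemma nilpotent_rank_lt k (A : 'M[F]_(k, d)) : (A *m N <= A)%MS -> A != 0 ->
  (\rank (A *m N) < \rank A)%N.
Proof.
move=> AN; rewrite ltn_neqAle mxrankS // andbT; apply: contra => /eqP rAN.
have sA : (A <= A *m N)%MS by rewrite -(mxrank_leqif_sup AN).2 rAN.
have sAl j : (A <= A *m N ^+ j)%MS.
  elim: j => [|j IH]; first by rewrite expr0 mulmx1.
  by rewrite exprSr mulmxA (submx_trans sA) // submxMr.
by have := sAl l; rewrite Nl mulmx0 => /submx0null ->.
Qed.

Lemma nilpotent_rank_exp k (A : 'M[F]_(k, d)) j : (A *m N <= A)%MS -> A *m N ^+ j != 0 ->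
  (\rank (A *m N ^+ j) + j <= \rank A)%N.
Proof.
move=> AN; elim: j => [|j IH] nz; first by rewrite expr0 mulmx1 addn0.
have nz' : A *m N ^+ j != 0.
  by apply: contra nz => /eqP h; rewrite exprSr mulmxA h mul0mx.
have AjN : (A *m N ^+ j *m N <= A *m N ^+ j)%MS.
  by rewrite -mulmxA -[N ^+ j *m N]exprSr exprS mulmxA submxMr.
rewrite addnS -addSn (leq_trans _ (IH nz')) // leq_add2r exprSr mulmxA.
exact: nilpotent_rank_lt.
Qed.

(** The kernel of N meets H in at most a line, so each application of N loses at most one dimension
    and H N^a is nonzero; each loses at least one, so H N^(a+1) = 0. *)
Lemma exists_cyclic_vector (H : 'M[F]_d) a : (H *m N <= H)%MS -> \rank H = a.+1 ->
  (\rank (H :&: kermx N) <= 1)%N ->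
  exists2 w : 'rV_d, (w <= H)%MS & w *m N ^+ a != 0 /\ w *m N ^+ a.+1 = 0.
Proof.
move=> HN rH rK.
have HjH j : (H *m N ^+ j <= H)%MS.
  elim: j => [|j IH]; first by rewrite expr0 mulmx1.
  by rewrite exprSr mulmxA (submx_trans _ HN) // submxMr.
have rj j : (a.+1 <= \rank (H *m N ^+ j) + j)%N.
  elim: j => [|j IH]; first by rewrite expr0 mulmx1 addn0 rH.
  have := mxrank_mul_ker (H *m N ^+ j) N.
  have := leq_trans (mxrankS (capmxS (HjH j) (submx_refl (kermx N)))) rK.
  move: IH; rewrite exprSr mulmxA.
  generalize (\rank (H *m N ^+ j :&: kermx N)) (\rank (H *m N ^+ j)) (\rank (H *m N ^+ j *m N)).
  by clear; lia.
have nz : H *m N ^+ a != 0.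
  by apply/eqP=> h; have := rj a; rewrite h mxrank0 add0n ltnn.
have z : H *m N ^+ a.+1 = 0.
  apply/eqP; apply: contraT => nz0; have := nilpotent_rank_exp HN nz0; rewrite rH.
  by rewrite -[X in (_ <= X)%N]add0n leq_add2r leqn0 mxrank_eq0 (negPf nz0).
have /row_subPn[i] : ~~ (H *m N ^+ a <= (0 : 'M_d))%MS by rewrite submx0.
rewrite row_mul submx0 => nzi; exists (row i H); rewrite ?row_sub //.
by rewrite nzi; split=> //; rewrite -row_mul z row0.
Qed.

(** The span T of the orbit of w is N-stable with T N^a nonzero, and every application of N to a
    nonzero stable space loses a dimension. *)
Lemma cyclic_rank (w : 'rV[F]_d) a : w *m N ^+ a != 0 -> w *m N ^+ a.+1 = 0 ->
  (a < \rank (\matrix_(i < d) (w *m N ^+ i)))%N.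
Proof.
move=> nz z; set T := \matrix_(i < d) _.
have TN : (T *m N <= T)%MS.
  apply/row_subP=> i; rewrite row_mul rowK -mulmxA -[_ *m N]exprSr.
  have [id|] := ltnP i.+1 d.
    by rewrite -[i.+1]/(nat_of_ord (Ordinal id)) -(rowK (fun i : 'I_d => w *m N ^+ i)) row_sub.
  move=> di; have {di} : (a < i.+1)%N.
    have HN : (1%:M *m N <= (1%:M : 'M_d))%MS by rewrite submx1.
    have nz' : 1%:M *m N ^+ a != 0.
      by apply: contra nz => /eqP h; rewrite mul1mx in h; rewrite h mulmx0.
    have := nilpotent_rank_exp HN nz'; rewrite mxrank1 => h.
    have := leq_trans h di; rewrite -mxrank_eq0 in nz'.
    by move: nz'; rewrite -lt0n; generalize (\rank (1%:M *m N ^+ a)); clear; lia.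
  by move=> ai; rewrite -(subnKC ai) exprD mulmxA z mul0mx sub0mx.
have nzT : T *m N ^+ a != 0.
  apply: contra nz => /eqP h; have := congr1 (row 0) h.
  by rewrite row_mul rowK row0 expr0 mulmx1 => ->.
have := nilpotent_rank_exp TN nzT; rewrite -mxrank_eq0 -lt0n in nzT.
by move: nzT; generalize (\rank (T *m N ^+ a)) (\rank T); clear; lia.
Qed.

End Nilpotent.

(** * Jordan types and Jordan bases *)

Section JordanType.
Local Open Scope ring_scope.
Variables (F : finFieldType) (n : nat) (x : {'GL_n[F]}).
Local Notation d := n.-1.+1.
Local Notation N := (GLval x - 1%:M).

Lemma row_jordan_mul lam (f : nat -> 'rV[F]_d) (i : 'I_d) :
  row i (unipotent_jordan_mx F n lam *m (\matrix_(j < d) f j))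
  = f i + (if (i.+1 < d)%N && (i.+1 \notin scanl addn 0%N lam) then f i.+1 else 0).
Proof.
rewrite row_mul mulmx_sum_row (bigD1 i) //= !mxE eqxx /= scale1r rowK; congr (_ + _).
case: ifP => [/andP[id nl]|h].
  rewrite (bigD1 (Ordinal id)) /=; last by rewrite -val_eqE /= neq_ltn ltnSn orbT.
  rewrite !mxE /= eqxx nl orbT scale1r rowK big1 ?addr0 // => j /andP[ji jS].
  by rewrite -val_eqE /= in jS; rewrite !mxE (negPf ji) (negPf jS) scale0r.
rewrite big1 // => j ji; rewrite !mxE (negPf ji) /=; case: eqP => [ej|]; last by rewrite scale0r.
by move: h; rewrite -ej ltn_ord /= => ->; rewrite scale0r.
Qed.

(** The vectors f i form a Jordan basis read block by block; i ends a block when i+1 is a partial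
    sum of lam. *)
Lemma has_jordan_typeP lam (f : nat -> 'rV[F]_d) : sumn lam = n ->
  \rank (\matrix_(j < d) f j) = d ->
  (forall i : 'I_d, f i *m N =
     if (i.+1 < d)%N && (i.+1 \notin scanl addn 0%N lam) then f i.+1 else 0) ->
  has_jordan_type lam x.
Proof.
move=> sl rf fN; split=> //; set P := \matrix_(j < d) f j in rf.
have uP : P \in unitmx by rewrite -row_free_unit -row_leq_rank rf.
exists P => //; apply/simmxP => //; apply/row_matrixP=> i.
rewrite row_jordan_mul -fN row_mul rowK mulmxBr mulmx1.
by rewrite addrC subrK.
Qed.

Lemma jordan_type_basis lam : has_jordan_type lam x ->
  exists2 P : 'M[F]_d, P \in unitmx & forall i : 'I_d, row i P *m N =
     if (i.+1 < d)%N && (i.+1 \notin scanl addn 0%N lam) then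
       row (inord i.+1) P else 0.
Proof.
move=> [_ [P uP /(simmxP uP) eP]]; exists P => // i.
have := congr1 (row i) eP.
have {2}-> : P = \matrix_(j < d) row (inord j) P.
  by apply/row_matrixP=> j; rewrite rowK inord_val.
rewrite (row_jordan_mul lam (fun j => row (inord j) P)) row_mul inord_val.
by move=> h; rewrite mulmxBr h mulmx1 addrC addKr.
Qed.

End JordanType.

(** * Regular elements and dimension 2 *)

Section SmallKernel.
Local Open Scope ring_scope.
Variables (F : finFieldType) (n : nat) (x : {'GL_n[F]}).
Local Notation d := n.-1.+1.
Local Notation N := (GLval x - 1%:M).

Lemma regular_of_rank_kermx l : (n.-1.+1 = n)%N -> N ^+ l = 0 ->
  (\rank (kermx N) <= 1)%N -> regular_unipotent x.
Proof.
move=> n0 Nl rK.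
have [|||w _ [nz z]] := @exists_cyclic_vector _ _ N l Nl 1%:M n.-1.
- by rewrite mul1mx submx1.
- by rewrite mxrank1.
- by rewrite (leq_trans (mxrankS (capmxSr _ _))).
apply: (@has_jordan_typeP _ _ _ _ (fun i => w *m N ^+ i)).
- by rewrite /= addn0.
- by apply/eqP; rewrite eqn_leq rank_leq_col (cyclic_rank Nl nz z).
move=> i; rewrite -mulmxA -[_ *m N]exprSr /= inE add0n.
rewrite -[X in _ != X]n0; have := ltn_ord i; rewrite leq_eqVlt => /orP[/eqP ei|id].
  by rewrite ei ltnn z.
by rewrite id neq_ltn id.
Qed.

(** For m = 1 no isotropic plane exists, but no case is left either: a nonzero N has kernel of
    dimension at most 1, and the identity has the exceptional type (1, 1). *)
Lemma regular_or_trivial_dim2 m l : (n.-1.+1 = 2 * m)%N -> m = 1%N -> N ^+ l = 0 ->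
  regular_unipotent x \/ has_jordan_type [:: n.-1; 1]%N x.
Proof.
move=> dm m1 Nl; have n2 : n = 2%N by move: dm; rewrite m1; clear; lia.
have [N0|nN0] := eqVneq N 0; last first.
  left; apply: (regular_of_rank_kermx _ Nl); first by rewrite n2.
  rewrite (mxrank_ker N) leq_subLR addn1; apply: leq_trans (_ : 2 <= _)%N; first by rewrite n2.
  by rewrite ltnS lt0n mxrank_eq0.
right; apply: (@has_jordan_typeP _ _ _ _ (fun i => delta_mx 0 (inord i))).
- by rewrite n2.
- rewrite (_ : \matrix_(j < d) _ = 1%:M) ?mxrank1 //.
  by apply/matrixP=> i j; rewrite !mxE inord_val eqxx eq_sym.
move=> i; rewrite N0 mulmx0 /= !inE add0n addn1; case: ifP => // h; exfalso.
by move: h n2; move: (nat_of_ord i); clear; lia.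
Qed.

End SmallKernel.

(** * The fixed space of a unipotent isometry *)

Section FixedSpace.
Local Open Scope ring_scope.
Variables (F : finFieldType) (s : {rmorphism F -> F}) (n m : nat).
Hypothesis sK : involutive s.
Hypothesis norm_surj : forall c, s c = c -> exists t, t * s t = c.
Local Notation d := n.-1.+1.
Hypothesis dm : d = (2 * m)%N.
Local Notation hform := (@hform F s n).
Local Notation perp := (@perp F s n _).
Local Notation gT := {'GL_n[F]}.
Local Notation SUs := (SUs s n).
Variable x : gT.
Hypothesis xG : x \in SUs.
Local Notation N := (GLval x - 1%:M).

(** If u is fixed, (u, v N) = (u, v x) - (u, v) = (u x, v x) - (u, v) = 0; the dimensions agree. *)
Lemma fix_perp_im : (kermx N :=: perp N)%MS.
Proof.
apply: eqmx_of_sub; last first.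
  by rewrite (mxrank_ker N) leq_subRL ?rank_leq_row // addnC rank_perp.
apply/perpP => // u w; rewrite sub_kermx => /eqP uN /submxP[v ->].
have ux : u *m GLval x = u.
  by apply/eqP; rewrite -subr_eq0 -{2}[u]mulmx1 -mulmxBr uN.
by rewrite mulmxBr mulmx1 hformDr hformNr -{1}ux SUs_formE // subrr.
Qed.

Lemma isotropic_pair k (A : 'M[F]_(k, d)) (e : 'rV[F]_d) :
  (e <= A)%MS -> e != 0 -> (A <= perp e)%MS -> (2 < \rank A)%N ->
  exists L : 'M[F]_d, [/\ \rank L = 2%N, (L <= perp L)%MS & (L <= A)%MS].
Proof.
move=> eA e0 Ae rA; have re : \rank e = 1%N by rewrite rank_rV e0.
have [|u uA /andP[nu /eqP uu]] := exists_isotropic_rel sK norm_surj eA.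
  by rewrite re.
exists (e + u)%MS; split; last by rewrite addsmx_sub eA.
  by rewrite rank_adds_vec // re.
apply: isotropic_adds => //.
- by rewrite (submx_trans eA).
- by rewrite hform_perp uu.
- by rewrite (submx_trans uA).
Qed.

Lemma fix_isotropic_or_jordan l : N ^+ l = 0 -> (1 < m)%N ->
  [\/ exists L : 'M[F]_d, [/\ \rank L = 2%N, (L <= perp L)%MS & L *m N = 0],
      regular_unipotent x | has_jordan_type [:: n.-1; 1]%N x].
Proof.
move=> Nl m1; have n0 : (n.-1.+1 = n)%N by lia.
have n1 : n.-1 = n.-2.+1 by lia.
have n1m : n.-1 = (2 * m - 1)%N by lia.
have [N0|nN0] := eqVneq N 0.
  constructor 1; have [|e _ /andP[e0 /eqP ee]] := @exists_isotropic _ _ n sK norm_surj _ (1%:M : 'M_d).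
    by rewrite mxrank1; lia.
  have [||||L [rL LL _]] := @isotropic_pair _ (perp e) e => //.
  - by rewrite hform_perp ee.
  - by rewrite (rank_perpE s dm) rank_rV e0; lia.
  by exists L; rewrite N0 mulmx0.
(* A row of the last nonzero power of N is fixed and lies in the image of N, so it is orthogonal to
   the whole fixed space. *)
have [e [eK eIm e0]] : exists e : 'rV[F]_d, [/\ (e <= kermx N)%MS, (e <= N)%MS & e != 0].
  have exP : exists j, N ^+ j.+1 == 0 by exists l; rewrite exprS Nl mulr0.
  have := ex_minnP exP; case=> -[|j] /eqP Nj jmin; first by case/eqP: nN0.
  have : N ^+ j.+1 != 0 by apply/negP=> /jmin; rewrite ltnn.
  rewrite -mxrank_eq0 -lt0n => rj.
  have /row_subPn[i nz] : ~~ (N ^+ j.+1 <= (0 : 'M_d))%MS.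
    by apply/negP=> /mxrankS; rewrite mxrank0 leqNgt rj.
  exists (row i (N ^+ j.+1)); split; last by rewrite -submx0.
    by rewrite sub_kermx -row_mul -[_ *m N]exprSr Nj row0.
  by rewrite (submx_trans (row_sub _ _)) // exprSr submxMl.
have Ke : (kermx N <= perp e)%MS by rewrite fix_perp_im perpS.
have [rK|rK] := ltnP 2 (\rank (kermx N)).
  constructor 1; have [L [rL LL LK]] := isotropic_pair eK e0 Ke rK.
  by exists L; split=> //; apply/eqP; rewrite -sub_kermx.
have re : \rank e = 1%N by rewrite rank_rV e0.
have [Kle|/exists_vec[v vK nve]] := boolP (kermx N <= e)%MS.
  constructor 2.
  apply: (regular_of_rank_kermx n0 Nl).
  by rewrite -re mxrankS.
have [vv|nvv] := eqVneq (hform v v) 0.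
  constructor 1; exists (e + v)%MS; split.
  - by rewrite rank_adds_vec ?re.
  - apply: isotropic_adds => //; first exact: submx_trans eK Ke.
      by rewrite hform_perp vv.
    exact: submx_trans vK Ke.
  by apply/eqP; rewrite -sub_kermx addsmx_sub eK.
constructor 3.
have vN : v *m N = 0 by apply/eqP; rewrite -sub_kermx.
have vx : (v *m GLval x <= v)%MS.
  have -> : v *m GLval x = v; last by [].
  by apply/eqP; rewrite -subr_eq0 -{2}[v]mulmx1 -mulmxBr vN.
have v0 : v != 0 by apply: contra nve => /eqP ->; rewrite sub0mx.
have rH : \rank (perp v) = n.-1 by rewrite (rank_perpE s dm) rank_rV v0 n1m.
have nvH : ~~ (v <= perp v)%MS by rewrite hform_perp.
have HN : (perp v *m N <= perp v)%MS by apply: perp_step => //; rewrite vN sub0mx.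
have [|||w wH [nz z]] := @exists_cyclic_vector _ _ N l Nl (perp v) n.-2.
- by [].
- by rewrite rH.
(* The fixed space has dimension at most 2 and contains v, which is not in [perp v]; so it meets
   [perp v] in at most a line. *)
- rewrite -ltnS (leq_trans _ rK) // ltn_neqAle mxrankS ?capmxSr // andbT.
  rewrite (mxrank_leqif_sup (capmxSr _ _)).2 sub_capmx submx_refl andbT.
  by apply: contra nvH; apply: submx_trans.
pose f i := if (i < n.-1)%N then w *m N ^+ i else v.
apply: (@has_jordan_typeP _ _ _ _ f).
- by rewrite /= addn0 addn1.
- apply/eqP; rewrite eqn_leq rank_leq_col /=.
  pose T := \matrix_(i < d) (w *m N ^+ i).
  have TH : (T <= perp v)%MS.
    apply/row_subP=> i; rewrite rowK; elim: (nat_of_ord i) => [|j IH]; first by rewrite mulmx1.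
    by rewrite exprSr mulmxA (submx_trans _ HN) // submxMr.
  have nvT : ~~ (v <= T)%MS by apply: contra nvH => /submx_trans; apply.
  have rT : (n.-1 <= \rank T)%N by have := cyclic_rank Nl nz z; rewrite -n1.
  apply: (@leq_trans (\rank (T + v)%MS)); first by rewrite rank_adds_vec.
  have fS i : (i < d)%N -> (f i <= \matrix_(j < d) f j)%MS.
    move=> id; rewrite -[i]/(nat_of_ord (Ordinal id)).
    by rewrite -(rowK (fun i : 'I_d => f i)) row_sub.
  apply: mxrankS; rewrite addsmx_sub; apply/andP; split.
    apply/row_subP=> i; rewrite rowK; have [id|di] := ltnP i n.-1.
      by have := fS i (ltn_ord i); rewrite /f id.
    have di' : (n.-2.+1 <= i)%N by rewrite -n1.
    by rewrite -(subnKC di') exprD mulmxA z mul0mx sub0mx.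
  by have := fS n.-1 (ltnSn _); rewrite /f ltnn.
move=> i; rewrite /f /= !inE add0n addn1.
have [id|di] := ltnP i n.-1.
  rewrite -mulmxA -[_ *m N]exprSr.
  have -> : (i.+1 < n.-1.+1)%N by rewrite ltnS.
  rewrite andTb; case: eqP => [ei|/eqP nei] /=.
    by rewrite ei [X in N ^+ X]n1 z.
  have lt : (i.+1 < n.-1)%N by rewrite ltn_neqAle nei.
  by rewrite lt neq_ltn (leq_trans lt) ?leq_pred.
by rewrite ltnS ltnNge di.
Qed.

End FixedSpace.

(** * Augmentation powers of a p-group of isometries *)

Section PGroupFiltration.
Local Open Scope ring_scope.
Variables (F : finFieldType) (n p : nat).
Hypothesis pF : p \in [pchar F].
Local Notation d := n.-1.+1.
Local Notation gT := {'GL_n[F]}.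
Variable Q : {group gT}.
Hypothesis pQ : (p.-group Q)%g.

(** In characteristic p, a p-group fixes a nonzero vector of the quotient by U; u is a lift of
    one. *)
Lemma pgroup_fixed_mod (U : 'M[F]_d) :
  (forall h, h \in Q -> (U *m GLval h <= U)%MS) -> (\rank U < d)%N ->
  exists2 u : 'rV_d, ~~ (u <= U)%MS &
    forall h, h \in Q -> (u *m (GLval h - 1%:M) <= U)%MS.
Proof.
move=> stU rU; have repQ : mx_repr Q (@GLval n F) by [].
pose rQ := MxRepresentation repQ.
have modU : mxmodule rQ U by apply/mxmoduleP.
have rcU : (0 < \rank (cokermx U))%N by rewrite mxrank_coker subn_gt0.
have := rfix_pgroup_pchar pF (factmod_repr modU) rcU pQ (subxx Q).
set W := rfix_mx _ _ => nW.
have /row_subPn[i nWi] : ~~ (W <= (0 : 'M_(\rank (cokermx U))))%MS by rewrite submx0.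
pose w := row i W; exists (val_factmod w).
  by rewrite -in_factmod_eq0 val_factmodK -submx0.
move=> h hQ; rewrite -in_factmod_eq0 mulmxBr mulmx1 linearB /=.
rewrite (in_factmodJ modU (val_factmod w) hQ) val_factmodK subr_eq0.
rewrite /w -row_mul; apply/eqP; congr row.
exact: (rfix_mx_id (factmod_repr modU) hQ).
Qed.

End PGroupFiltration.

Section AugmentationFiltration.
Local Open Scope ring_scope.
Variables (F : finFieldType) (s : {rmorphism F -> F}) (n p : nat).
Hypothesis sK : involutive s.
Hypothesis pF : p \in [pchar F].
Local Notation d := n.-1.+1.
Local Notation gT := {'GL_n[F]}.
Local Notation hform := (@hform F s n).
Local Notation perp := (@perp F s n _).
Local Notation SUs := (SUs s n).
Variable Q : {group gT}.
Hypothesis pQ : (p.-group Q)%g.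
Hypothesis sQG : Q \subset SUs.

(* [aug k] is the image of the [k]-th power of the augmentation ideal of [Q]. *)
Fixpoint aug k : 'M[F]_d :=
  if k is k'.+1 then (\sum_(h in Q) <<aug k' *m (GLval h - 1%:M)>>)%MS else 1%:M.

Lemma augS_sub k h : h \in Q -> (aug k *m (GLval h - 1%:M) <= aug k.+1)%MS.
Proof. by move=> hQ /=; apply: (sumsmx_sup h); rewrite ?genmxE. Qed.

Lemma aug_sub k l (A : 'M[F]_(l, d)) :
  (forall h, h \in Q -> (aug k *m (GLval h - 1%:M) <= A)%MS) -> (aug k.+1 <= A)%MS.
Proof. by move=> hA; apply/sumsmx_subP=> h hQ; rewrite genmxE hA. Qed.

Lemma augS k : (aug k.+1 <= aug k)%MS.
Proof.
elim: k => [|k IH]; first exact: submx1.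
apply: aug_sub => h hQ; apply: submx_trans (augS_sub k hQ).
exact: submxMr.
Qed.

Lemma aug_le j k : (j <= k)%N -> (aug k <= aug j)%MS.
Proof.
move/subnK <-; elim: (k - j)%N => [|i IH] //; exact: submx_trans (augS _) IH.
Qed.

Lemma aug_stable k h : h \in Q -> (aug k *m GLval h <= aug k)%MS.
Proof.
move=> hQ; rewrite -[GLval h](subrK 1%:M) mulmxDr mulmx1 addmx_sub //.
exact: submx_trans (augS_sub k hQ) (augS k).
Qed.

(** Conjugation by g permutes the elements h - 1 which generate the augmentation ideal. *)
Lemma aug_norm k g : g \in 'N(Q)%g -> (aug k *m GLval g <= aug k)%MS.
Proof.
move=> gN; elim: k => [|k IH]; first exact: submx1.
rewrite (sumsmxMr_gen) /=; apply/sumsmx_subP=> h hQ; rewrite genmxE.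
rewrite (eqmxMr _ (genmxE _)).
have -> : aug k *m (GLval h - 1%:M) *m GLval g
   = aug k *m GLval g *m (GLval (h ^ g)%g - 1%:M).
  rewrite !mulmxBr !mulmx1 mulmxBl conjgE !GL_MxE !mulmxA.
  by congr (_ - _); rewrite -[in RHS](mulmxA (aug k)) -GL_MxE mulgV GL_1E mulmx1.
apply: submx_trans (augS_sub k (_ : (h ^ g)%g \in Q)); last by rewrite memJ_norm.
exact: submxMr.
Qed.

(* A vector fixed by [Q] modulo [perp (aug k)] is orthogonal to [aug k.+1]. *)
Lemma aug_lt k : aug k != 0 -> (\rank (aug k.+1) < \rank (aug k))%N.
Proof.
move=> nz; rewrite ltn_neqAle mxrankS ?augS // andbT.
apply/negP=> /eqP r; have sA : (aug k <= aug k.+1)%MS.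
  by rewrite -(mxrank_leqif_sup (augS k)).2 r.
have [h hQ||u nu hu] := @pgroup_fixed_mod _ _ _ pF _ pQ (perp (aug k)).
- by rewrite stable_perp ?(subsetP sQG) // aug_stable.
- have := rank_perp s (aug k); rewrite -mxrank_eq0 -lt0n in nz.
  by move: nz; generalize (\rank (perp (aug k))) (\rank (aug k)); clear; lia.
case/negP: nu; rewrite perp_sym //; apply: submx_trans sA _; apply: aug_sub => h hQ.
apply/perpP => // v w /submxP[a ->] /sub_rVP[c ->]; rewrite mulmxA hformZr.
set b := a *m aug k; have bA : (b <= aug k)%MS by rewrite submxMl.
have hG := subsetP sQG _ hQ.
(* The adjoint of h - 1 for the form is h^-1 - 1. *)
have huV := hu _ (mem_GLV hQ).
have h1 : hform b (u *m (GLval h^-1%g - 1%:M)) = 0.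
  have hperp : (aug k <= perp (perp (aug k)))%MS by rewrite perp_sym.
  have := hform_sub sK hperp bA huV. done.
have h2 := SUs_formE b (u *m GLval h^-1%g) hG.
rewrite mulGLKV in h2.
by rewrite mulmxBr mulmx1 hformDl hformNl h2 -hformNr -hformDr -{2}[u]mulmx1 -mulmxBr h1 mulr0.
Qed.

Lemma aug_nilpotent : exists k, aug k == 0.
Proof.
exists d; rewrite -mxrank_eq0.
suff h k : (\rank (aug k) <= d - k)%N by have := h d; rewrite subnn leqn0.
elim: k => [|k IH]; first by rewrite subn0 rank_leq_row.
have [z|nz] := eqVneq (aug k) 0.
  by have := mxrankS (augS k); rewrite z mxrank0 leqn0 => /eqP ->.
have := leq_trans (aug_lt nz) IH; rewrite subnS.
by case: (n.-1.+1 - k)%N.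
Qed.

(** The adjoint h^-1 - 1 of h - 1 is again in the augmentation ideal, so factors can be moved one at
    a time from [aug b] to [aug a]. *)
Lemma aug_perp a b : aug (a + b) = 0 -> (aug a <= perp (aug b))%MS.
Proof.
elim: b a => [|b IH] a ab; first by rewrite -[a]addn0 ab sub0mx.
rewrite perp_sym //; apply: aug_sub => h hQ.
have hG := subsetP sQG _ hQ.
have hab : (aug a.+1 <= perp (aug b))%MS by apply: IH; rewrite addSnnS.
apply/perpP => // v w /submxP[c ->] wA; rewrite mulmxA.
set v' := c *m aug b; have v'A : (v' <= aug b)%MS by rewrite submxMl.
have h1 : hform v' (w *m (GLval h^-1%g - 1%:M)) = 0.
  rewrite perp_sym // in hab; apply: (hform_sub sK hab v'A).
  by rewrite (submx_trans _ (augS_sub a (mem_GLV hQ))) // submxMr.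
have h2 := SUs_formE v' (w *m GLval h^-1%g) hG.
rewrite mulGLKV in h2.
by rewrite mulmxBr mulmx1 hformDl hformNl h2 -hformNr -hformDr -{2}[w]mulmx1 -mulmxBr h1.
Qed.

Lemma aug_exp x k : x \in Q -> ((GLval x - 1%:M) ^+ k <= aug k)%MS.
Proof.
move=> xQ; elim: k => [|k IH]; first by rewrite submx1.
by rewrite exprSr (submx_trans _ (augS_sub k xQ)) // submxMr.
Qed.

Lemma aug_mul_exp x k j : x \in Q -> (aug j *m (GLval x - 1%:M) ^+ k <= aug (j + k)%N)%MS.
Proof.
move=> xQ; elim: k => [|k IH]; first by rewrite expr0 mulmx1 addn0.
by rewrite addnS exprSr mulmxA (submx_trans _ (augS_sub _ xQ)) // submxMr.
Qed.

(** The filtration drops strictly until it vanishes, which is not before step r. *)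
Lemma rank_aug r i : (i <= r)%N -> (forall k, aug k == 0 -> (r <= k)%N) ->
  (i <= \rank (aug (r - i)%N))%N.
Proof.
move=> ir rmin; elim: i ir => // i IH ir.
have nz : aug (r - i.+1)%N != 0.
  by apply/negP=> /rmin; rewrite leqNgt -{2}(subnK ir) addnS ltnS leq_addr.
have := aug_lt nz; rewrite -subSn // subSS => lt.
exact: leq_ltn_trans (IH (ltnW ir)) lt.
Qed.

End AugmentationFiltration.

(** * Elements of type (2m-1, 1) *)

Section AlmostRegular.
Local Open Scope ring_scope.
Variables (F : finFieldType) (s : {rmorphism F -> F}) (n m p : nat).
Hypothesis sK : involutive s.
Hypothesis pF : p \in [pchar F].
Local Notation d := n.-1.+1.
Hypothesis dm : d = (2 * m)%N.
Hypothesis m0 : (0 < m)%N.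
Hypothesis n0 : (0 < n)%N.
Local Notation hform := (@hform F s n).
Local Notation perp := (@perp F s n _).
Local Notation gT := {'GL_n[F]}.
Local Notation SUs := (SUs s n).
Variable x : gT.
Hypothesis xG : x \in SUs.
Local Notation N := (GLval x - 1%:M).
Variable l : nat.
Hypothesis Nl : N ^+ l = 0.
Hypothesis xJ : has_jordan_type [:: n.-1; 1]%N x.

Lemma scanl_in i : (i \in scanl addn 0%N [:: n.-1; 1]%N) = (i == n.-1) || (i == n).
Proof. by rewrite /= !inE add0n addn1 prednK. Qed.

Lemma rank_almost_regular_le : (\rank N <= n.-2)%N.
Proof.
have [P uP hP] := jordan_type_basis xJ.
pose R := \matrix_(i < n.-2) row (inord i.+1) P.
have PNR : (P *m N <= R)%MS.
  apply/row_subP=> i; rewrite row_mul hP scanl_in.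
  case: ifP => [/andP[id]|_]; last exact: sub0mx.
  rewrite negb_or => /andP[ni _]; have lti : (i < n.-2)%N by move: (id) ni; clear; lia.
  have <- : row (Ordinal lti) R = row (inord i.+1) P by rewrite rowK.
  exact: row_sub.
have <- : \rank (P *m N) = \rank N.
  by rewrite (eqmxMfull N (_ : row_full P)) ?row_full_unit.
exact: leq_trans (mxrankS PNR) (rank_leq_row _).
Qed.

Lemma rank_kermx_almost_regular : (2 <= \rank (kermx N))%N.
Proof.
rewrite (mxrank_ker N); apply: leq_trans (leq_sub2l _ rank_almost_regular_le).
by move: dm; clear -m0; lia.
Qed.

Lemma almost_regular_exp_neq0 : N ^+ n.-2 != 0.
Proof.
have [P uP hP] := jordan_type_basis xJ.
have PN j : (j <= n.-2)%N -> row ord0 P *m N ^+ j = row (inord j) P.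
  elim: j => [|j IH] jn; first by rewrite expr0 mulmx1 -[ord0]inord_val.
  have jd : (j < d)%N by move: jn; clear; lia.
  rewrite exprSr mulmxA (IH (ltnW jn)) hP scanl_in inordK //.
  by rewrite (_ : _ && _); last by move: jn; clear -n0; lia.
apply/eqP=> N0; have := PN _ (leqnn _); rewrite N0 mulmx0 => /esym/(congr1 (mulmxr (invmx P))).
rewrite /= -row_mul mulmxV // mul0mx => /matrixP/(_ 0 (inord n.-2)).
by rewrite !mxE eqxx => /eqP; rewrite oner_eq0.
Qed.

Lemma almost_regular_exp_eq0 : N ^+ n.-1 = 0.
Proof.
apply/eqP; apply: contraT => nz; have := rank_almost_regular_le.
have [n2|n2] := posnP n.-2.
  rewrite n2 leqn0 mxrank_eq0 => /eqP N0; case/negP: nz.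
  have n1 : n.-1 = 1%N by move: dm n2; clear -m0; lia.
  by rewrite [X in N ^+ X]n1 N0.
have e : N ^+ n.-1 = N *m N ^+ n.-2 by rewrite -[RHS]exprS; congr (_ ^+ _); move: n2; clear; lia.
rewrite e in nz; have NN : (N *m N <= N)%MS by rewrite submxMl.
move=> rN; have := leq_trans (nilpotent_rank_exp Nl NN nz) rN.
by rewrite -[X in (_ <= X)%N]add0n leq_add2r leqn0 mxrank_eq0 (negPf nz).
Qed.

(** Below N^(n-2), which is nonzero, and above N, of rank at most n-2, every power loses at least
    one dimension; this pins down all ranks. *)
Lemma rank_almost_regular_exp k : (0 < k <= n.-1)%N -> \rank (N ^+ k) = (n.-1 - k)%N.
Proof.
move=> k0; have [->|nk] := eqVneq k n.-1.
  by rewrite almost_regular_exp_eq0 mxrank0 subnn.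
have kn : (k <= n.-2)%N by move: k0 nk; clear; lia.
have stab : (N ^+ k *m N <= N ^+ k)%MS by rewrite -[_ *m N]exprSr exprS submxMl.
have nz' := almost_regular_exp_neq0.
have h1 : (\rank (N ^+ n.-2) + (n.-2 - k) <= \rank (N ^+ k))%N.
  have e : N ^+ n.-2 = N ^+ k *m N ^+ (n.-2 - k) by rewrite -[RHS]exprD subnKC.
  have nze : N ^+ k *m N ^+ (n.-2 - k) != 0 by rewrite -e.
  by have := nilpotent_rank_exp Nl stab nze; rewrite -e.
have kk : k.-1.+1 = k by move: k0; clear; lia.
have nzk : N *m N ^+ k.-1 != 0.
  rewrite -[N *m _]exprS kk.
  by apply: contra nz' => /eqP h; rewrite -(subnKC kn) exprD h mul0r.
have NN : (N *m N <= N)%MS by rewrite submxMl.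
have h2 := nilpotent_rank_exp Nl NN nzk; have h3 := rank_almost_regular_le.
rewrite -[N *m _]exprS kk in h2.
rewrite -mxrank_eq0 -lt0n in nz'.
move: h1 h2 h3 nz'; generalize (\rank (N ^+ n.-2)) (\rank (N ^+ k)) (\rank N).
by move: k0 kn; clear; lia.
Qed.

Lemma stable_expN k : (N ^+ k *m GLval x <= N ^+ k)%MS.
Proof.
have -> : N ^+ k *m GLval x = N ^+ k *m N + N ^+ k by rewrite mulmxBr mulmx1 subrK.
by rewrite addmx_sub // -[_ *m N]exprSr exprS submxMl.
Qed.

(** The adjoint of N is x^-1 - 1 = -x^-1 N, which is N up to a unit commuting with it. *)
Lemma perp_exp k : (perp (N ^+ k) :=: kermx (N ^+ k))%MS.
Proof.
apply: eqmx_of_sub.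
  rewrite sub_kermx -submx0.
  suff h j : (j <= k)%N -> (perp (N ^+ k) *m N ^+ j <= perp (N ^+ (k - j)))%MS.
    rewrite (submx_trans (h k (leqnn k))) // subnn expr0.
    have := rank_perp s (1%:M : 'M[F]_d); rewrite mxrank1 => /eqP.
    by rewrite -[X in _ == X]add0n eqn_add2r mxrank_eq0 => /eqP ->; rewrite sub0mx.
  elim: j => [|j IH] jk; first by rewrite expr0 mulmx1 subn0.
  rewrite exprSr mulmxA (submx_trans (submxMr _ (IH (ltnW jk)))) //.
  apply: perp_step => //; first exact: stable_expN.
  by rewrite -[_ *m N]exprSr -subSn // subSS.
by rewrite (mxrank_ker (N ^+ k)) leq_subLR addnC rank_perp.
Qed.

Definition im_flag i := N ^+ (n.-1 - i).

Lemma rank_im_flag i : (i < m)%N -> \rank (im_flag i) = i.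
Proof.
move=> im; rewrite /im_flag rank_almost_regular_exp; last by move: dm im; clear; lia.
by move: dm im; clear; lia.
Qed.

Lemma im_flagS i : (i.+1 < m)%N -> (im_flag i.+1 *m N = im_flag i)%MS.
Proof.
move=> im; rewrite -[_ *m N]exprSr; congr (_ ^+ _).
by move: dm im; clear; lia.
Qed.

Lemma im_flag_sub i : (i.+1 < m)%N -> (im_flag i <= im_flag i.+1)%MS.
Proof. by move=> im; rewrite -im_flagS // -[_ *m N]exprSr exprS submxMl. Qed.

Lemma exp_sub j k : (j <= k)%N -> (N ^+ k <= N ^+ j)%MS.
Proof. by move=> jk; rewrite -(subnK jk) exprD submxMl. Qed.

Lemma exp_large k : (n.-1 <= k)%N -> N ^+ k = 0.
Proof. by move=> h; rewrite -(subnK h) exprD almost_regular_exp_eq0 mulr0. Qed.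

Lemma im_flag_isotropic i : (i < m)%N -> (im_flag i <= perp (im_flag i))%MS.
Proof.
move=> im; rewrite perp_exp sub_kermx -[_ *m _]exprD exp_large //.
by move: dm im; clear; lia.
Qed.

Lemma im_flag0 : im_flag 0 = 0.
Proof. by rewrite /im_flag subn0 almost_regular_exp_eq0. Qed.

Lemma almost_regular_in_radical : x \in chain_radical s im_flag m.-1.
Proof.
apply/chain_radicalP; split.
- by apply/chain_stabP; split=> // k _; apply: stable_expN.
- move=> k km; rewrite im_flagS //; by move: km; clear; lia.
have e : (n.-1 - m.-1 = m)%N by move: dm; clear -m0; lia.
rewrite /im_flag e (eqmxMr _ (perp_exp m)).
(* N^(m-1) lies in the kernel of N^m because N^(2m-1) = 0. That kernel has dimension m+1 and
   contains the fixed space, of dimension at least 2; so N maps it onto a space of dimension at most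
   m-1, the rank of N^m. *)
have sub : (N ^+ m <= kermx (N ^+ m) *m N)%MS.
  rewrite -{1}(prednK m0) exprSr submxMr // sub_kermx -[_ *m _]exprD exp_large //.
  by move: dm; clear -m0; lia.
suff -> : (kermx (N ^+ m) *m N :=: N ^+ m)%MS by [].
apply: eqmx_sym; apply: eqmx_of_sub => //.
have h1 := mxrank_mul_ker (kermx (N ^+ m)) N.
have h2 : (kermx N <= kermx (N ^+ m) :&: kermx N)%MS.
  rewrite sub_capmx submx_refl andbT sub_kermx -(prednK m0) exprS mulmxA.
  by rewrite mulmx_ker mul0mx.
have {}h2 := leq_trans rank_kermx_almost_regular (mxrankS h2).
rewrite (mxrank_ker (N ^+ m)) rank_almost_regular_exp in h1; last by move: dm; clear -m0; lia.
rewrite rank_almost_regular_exp; last by move: dm; clear -m0; lia.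
rewrite (canRL (addnK _) h1); apply: leq_trans (leq_sub2l _ h2) _.
by move: dm; clear -m0; lia.
Qed.

(** An isotropic kernel of N^i would lie in the image of N^i, so ker N would lie in im N. Then N^2
    would have rank at most (n-2) - 2, but its rank is n-3. *)
Lemma kermx_exp_not_isotropic i : (0 < i < m)%N ->
  ~~ (kermx (N ^+ i) <= perp (kermx (N ^+ i)))%MS.
Proof.
move=> i0; apply/negP=> h.
have {}h : (kermx (N ^+ i) <= N ^+ i)%MS.
  by rewrite -(perpK sK (N ^+ i)) (eqmx_perp sK (perp_exp i)).
have {}h : (kermx N <= N)%MS.
  have kk : (kermx N <= kermx (N ^+ i))%MS.
    have -> : i = i.-1.+1 by move: i0; clear; lia.
    by rewrite sub_kermx exprS mulmxA mulmx_ker mul0mx.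
  apply: submx_trans kk (submx_trans h _).
  by rewrite -[X in (_ <= X)%MS]expr1 exp_sub //; case/andP: i0.
have h1 := mxrank_mul_ker N N; have h2 : (kermx N <= N :&: kermx N)%MS.
  by rewrite sub_capmx h submx_refl.
have {}h2 := leq_trans rank_kermx_almost_regular (mxrankS h2).
have h3 := rank_almost_regular_le.
rewrite -[N *m N]expr2 rank_almost_regular_exp in h1; last by move: dm i0; clear; lia.
move: h1 h2 h3; generalize (\rank N) (\rank (N :&: kermx N)%MS).
by move: dm i0; clear; lia.
Qed.

(** Y + [im_flag i] is isotropic in the kernel of N^i, which has dimension i+1 and is not isotropic;
    so the sum has dimension at most i. *)
Lemma im_flag_unique i k (Y : 'M[F]_(k, d)) : (0 < i < m)%N ->
  (Y <= kermx (N ^+ i))%MS -> (Y <= perp Y)%MS -> (i <= \rank Y)%N ->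
  (Y :=: im_flag i)%MS.
Proof.
move=> i0 YK YY rY; have im : (i < m)%N by case/andP: i0.
have WK : (im_flag i <= kermx (N ^+ i))%MS.
  rewrite sub_kermx -[_ *m _]exprD exp_large //.
  by move: dm i0; clear; lia.
have KW : (kermx (N ^+ i) <= perp (im_flag i))%MS.
  by rewrite -perp_exp perpS // exp_sub //; move: dm i0; clear; lia.
have sub : (Y + im_flag i <= kermx (N ^+ i))%MS by rewrite addsmx_sub YK.
have iso : (Y + im_flag i <= perp (Y + im_flag i)%MS)%MS.
  apply: isotropic_adds => //; first exact: im_flag_isotropic.
  by rewrite perp_sym // (submx_trans YK).
have rk : (\rank (Y + im_flag i)%MS <= i)%N.
  rewrite -ltnS; have rK : \rank (kermx (N ^+ i)) = i.+1.
    rewrite mxrank_ker rank_almost_regular_exp; last by move: dm i0; clear; lia.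
    by move: dm i0; clear; lia.
  rewrite -rK ltn_neqAle mxrankS // andbT (mxrank_leqif_sup sub).2.
  apply: contra (kermx_exp_not_isotropic i0) => K.
  exact: submx_trans K (submx_trans iso (perpS sK K)).
have eW : (im_flag i :=: Y + im_flag i)%MS.
  by apply: eqmx_of_sub; rewrite ?addsmxSr // rank_im_flag.
apply: eqmx_of_sub; last by rewrite rank_im_flag.
by rewrite eW addsmxSl.
Qed.

(* [Q := 'O_p(<<g, x>>)] contains [x].  If [r] is the nilpotency length of its
   augmentation ideal, the [g]-stable space [aug Q (r - i)] is isotropic, killed by
   [N ^+ i], and of dimension at least [i], hence equal to [im_flag i]. *)
Lemma almost_regular_subnormalizer g :
  g \in subnormalizer_set SUs <[x]>%g -> g \in chain_stab s im_flag m.-1.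
Proof.
rewrite [g \in subnormalizer_set _ _]inE => /andP[gG sub]; apply/chain_stabP; split=> // i im.
have [->|i0] := posnP i; first by rewrite im_flag0 mul0mx sub0mx.
have {i0}i0m : (0 < i < m)%N by rewrite i0 -(prednK m0) ltnS.
pose K := <<g |: <[x]> >>%G.
have sKG : K \subset SUs.
  by rewrite (gen_subG _ (SUs_group s n)) subUset sub1set gG (cycle_subG _ (SUs_group s n)).
have pX : (p.-group <[x]>)%g.
  have [j xj] := GL_unipotent_exp pF Nl.
  rewrite /pgroup -orderE (@pnat_dvd _ (p ^ j)) ?order_dvdn ?xj //.
  by rewrite pnatX pnat_id ?orbT // (pcharf_prime pF).
have sXQ := subnormal_pcore (G := K) pX sub.
set Q := ('O_p(K))%G; have pQ : (p.-group Q)%g := pcore_pgroup p K.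
have sQG : Q \subset SUs := subset_trans (pcore_sub p K) sKG.
have xQ : x \in Q by rewrite -cycle_subG.
have gN : g \in 'N(Q)%g.
  apply: (subsetP (gFnorm _ K)); apply: mem_gen; exact: setU11.
have [r /eqP r0 rmin] := ex_minnP (aug_nilpotent sK pF pQ sQG).
(* N^(n-2) is nonzero and lies in [aug Q n.-2]. The bound r >= 2m-1 >= 2i gives 2(r-i) >= r, whence
   [aug Q (r - i)] is isotropic. *)
have rn : (n.-1 <= r)%N.
  rewrite leqNgt; apply/negP=> rn; case/negP: almost_regular_exp_neq0.
  have rn2 : (r <= n.-2)%N by move: rn; clear; lia.
  rewrite -submx0 (submx_trans (aug_exp n.-2 xQ)) //.
  by rewrite (submx_trans (aug_le Q rn2)) // r0.
have ri : (i <= r)%N by move: rn i0m dm; clear; lia.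
have Y : (aug Q (r - i) :=: im_flag i)%MS.
  apply: im_flag_unique => //.
  - rewrite sub_kermx -submx0 (submx_trans (aug_mul_exp _ _ xQ)) //.
    by rewrite subnK // r0.
  - apply: aug_perp => //; apply/eqP; rewrite -submx0 -r0 aug_le //.
    by move: rn i0m dm; clear; lia.
  by apply: (rank_aug sK pF pQ sQG) => // k k0; apply: rmin.
by rewrite -(eqmxMr _ Y) -Y aug_norm.
Qed.

Lemma SubG_almost_regular : SubG SUs x = chain_stab s im_flag m.-1.
Proof.
apply/eqP; rewrite eqEsubset; apply/andP; split.
  rewrite (gen_subG _ (chain_stab_group s im_flag m.-1)).
  by apply/subsetP=> g; apply: almost_regular_subnormalizer.
apply/subsetP=> g gS; apply: mem_gen.
exact: (chain_stab_subnormalizer sK pF im_flag0 almost_regular_in_radical).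
Qed.

End AlmostRegular.

(** * The standard flag and the Borel subgroup *)

Section StandardFlag.
Local Open Scope ring_scope.
Variables (F : finFieldType) (s : {rmorphism F -> F}) (n m p : nat).
Hypothesis sK : involutive s.
Local Notation d := n.-1.+1.
Hypothesis dm : d = (2 * m)%N.
Hypothesis m0 : (0 < m)%N.
Local Notation hform := (@hform F s n).
Local Notation perp := (@perp F s n _).
Local Notation gT := {'GL_n[F]}.
Local Notation SUs := (SUs s n).

(** The span of the last k basis vectors: the action is on rows from the right, and upper triangular
    matrices preserve these tails of the basis. *)
Definition std_flag k : 'M[F]_d := copid_mx (d - k).

Lemma sub_std_flagP k l (A : 'M[F]_(l, d)) :
  reflect (forall i (j : 'I_d), (j + k < d)%N -> A i j = 0) (A <= std_flag k)%MS.
Proof.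
have pidE l' (B : 'M[F]_(l', d)) i (j : 'I_d) :
    (B *m (pid_mx (d - k) : 'M_d)) i j = B i j *+ (j + k < d)%N.
  rewrite mxE (bigD1 j) //= big1 => [|t tj]; last first.
    by rewrite mxE -val_eqE /= in tj *; rewrite (negPf tj) mulr0.
  by rewrite mxE eqxx /= addr0 mulr_natr ltn_subRL addnC.
apply: (iffP idP) => [/submxP[D ->] i j jk|hA].
  have := pidE _ (D *m std_flag k) i j; rewrite jk mulr1n => <-.
  by rewrite -mulmxA mul_copid_mx_pid ?leq_subr // mulmx0 mxE.
have A0 : A *m (pid_mx (d - k) : 'M_d) = 0.
  by apply/matrixP=> i j; rewrite pidE mxE; case: (ltnP (j + k) d) => // jk; rewrite (hA i j jk).
have -> : A = A *m std_flag k by rewrite mulmxBr mulmx1 A0 subr0.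
exact: submxMl.
Qed.

Lemma rank_std_flag k : (k <= d)%N -> \rank (std_flag k) = k.
Proof. by move=> kd; rewrite rank_copid_mx ?leq_subr // subKn. Qed.

Lemma hform_sum (u v : 'rV[F]_d) :
  hform u v = \sum_j u 0 (rev_ord j) * s (v 0 j).
Proof.
by rewrite /hform row_antidiag mxE; apply: eq_bigr => j _; rewrite !mxE.
Qed.

Lemma std_flag_perp j k : (j + k <= d)%N -> (std_flag j <= perp (std_flag k))%MS.
Proof.
move=> jk; apply/perpP => // u v /sub_std_flagP uj /sub_std_flagP vk.
rewrite hform_sum big1 // => i _.
have [ik|ki] := ltnP (i + k) d; first by rewrite vk // rmorph0 mulr0.
rewrite uj ?mul0r //= subSS.
by move: (ltn_ord i) ki jk; clear; lia.
Qed.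

Lemma perp_std_flag k : (k <= d)%N -> (perp (std_flag k) :=: std_flag (d - k))%MS.
Proof.
move=> kd; apply: eqmx_sym; apply: eqmx_of_sub; first by rewrite std_flag_perp // subnK.
have := rank_perp s (std_flag k); rewrite rank_std_flag // => /(canRL (addnK _)) ->.
by rewrite rank_std_flag // leq_subr.
Qed.

Lemma std_flagS j k : (j <= k)%N -> (std_flag j <= std_flag k)%MS.
Proof.
move=> jk; apply/sub_std_flagP=> i t tk.
have /sub_std_flagP -> // := submx_refl (std_flag j).
by rewrite (leq_ltn_trans _ tk) // leq_add2l.
Qed.

Lemma isflag_std : isflag s m std_flag.
Proof.
split=> [k km|k km|]; first by rewrite rank_std_flag // dm; move: km; clear; lia.
  exact: std_flagS.
by rewrite std_flag_perp // dm mul2n addnn.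
Qed.

(** The tails of dimension above m are orthogonals of those of dimension below m, hence stable as
    well. *)
Lemma chain_stab_std_upper (g : gT) : g \in chain_stab s std_flag m ->
  is_trig_mx (GLval g)^T.
Proof.
case/chain_stabP=> gG gE; apply/is_trig_mxP => i j ij; rewrite mxE.
have stab k : (k <= d)%N -> (std_flag k *m GLval g <= std_flag k)%MS.
  move=> kd; have [km|mk] := leqP k m; first exact: gE.
  have dk : (d - k <= m)%N by move: dm mk; clear; lia.
  have := stable_perp sK gG (gE _ dk); have := perp_std_flag (leq_subr k d).
  by rewrite subKn // => e; rewrite -(eqmxMr _ e) => h; rewrite -e.
have jd : (d - j <= d)%N := leq_subr _ _.
have ej : ((delta_mx 0 j : 'rV[F]_d) <= std_flag (d - j))%MS.
  apply/sub_std_flagP=> t t' tj; rewrite mxE; case: eqP => // _; case: eqP => // e.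
  by move: tj; rewrite e subnKC ?ltnn // ltnW.
have := submx_trans (submxMr (GLval g) ej) (stab _ jd); rewrite -rowE.
move/sub_std_flagP/(_ 0 i); rewrite mxE; apply.
by move: ij (ltn_ord j); clear; lia.
Qed.

Lemma upper_chain_stab_std (g : gT) : g \in SUs -> is_trig_mx (GLval g)^T ->
  g \in chain_stab s std_flag m.
Proof.
move=> gG /is_trig_mxP gT; apply/chain_stabP; split=> // k km.
apply/row_subP=> i; rewrite row_mul; apply/sub_std_flagP=> i' j jk.
rewrite mxE big1 // => t _; have [tj|jt] := leqP t j.
  have /sub_std_flagP h := row_sub i (std_flag k).
  by rewrite h ?mul0r // (leq_ltn_trans _ jk) // leq_add2r.
by have := gT _ _ jt; rewrite mxE => ->; rewrite mulr0.
Qed.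

Lemma chain_stabW r r' : (r <= r')%N ->
  chain_stab s std_flag r' \subset chain_stab s std_flag r.
Proof.
move=> rr; apply/subsetP=> g /chain_stabP[gG gE]; apply/chain_stabP; split=> // k kr.
by apply: gE; apply: leq_trans rr.
Qed.

Hypothesis pF : p \in [pchar F].
Hypothesis s_nontriv : exists a, s a != a.

Lemma lt_i0 : (m.-1 < d)%N. Proof. by move: dm; clear -m0; lia. Qed.
Lemma lt_i1 : (m < d)%N. Proof. by move: dm; clear -m0; lia. Qed.
Local Notation i0 := (inord m.-1 : 'I_d).
Local Notation i1 := (inord m : 'I_d).
Local Notation e0 := (delta_mx 0 i0 : 'rV[F]_d).
Local Notation e1 := (delta_mx 0 i1 : 'rV[F]_d).

Lemma i0E : i0 = m.-1 :> nat. Proof. by rewrite inordK // lt_i0. Qed.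
Lemma i1E : i1 = m :> nat. Proof. by rewrite inordK // lt_i1. Qed.

Lemma rev_i0 : rev_ord i0 = i1.
Proof. by apply: val_inj; rewrite /= i0E i1E subSS; move: dm; clear -m0; lia. Qed.

Lemma rev_i1 : rev_ord i1 = i0.
Proof. by rewrite -rev_i0 rev_ordK. Qed.

Lemma i0_neq_i1 : i0 != i1.
Proof. by rewrite -val_eqE /= i0E i1E; move: m0; clear; lia. Qed.

Lemma hform_deltar (v : 'rV[F]_d) (i : 'I_d) : hform v (delta_mx 0 i) = v 0 (rev_ord i).
Proof.
rewrite hform_sum (bigD1 i) //= big1 => [|j ji].
  by rewrite mxE !eqxx rmorph1 mulr1 addr0.
by rewrite mxE (negPf ji) andbF rmorph0 mulr0.
Qed.

(** For z = w the Eichler transformation has coefficient a - s a; with t of trace 1 and a = c t this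
    is c (t + s t) = c. *)
Lemma exists_transvection (i : 'I_d) c : i != rev_ord i -> s c = - c ->
  exists2 g : gT, g \in SUs & forall v : 'rV_d,
    v *m GLval g = v + (c * v 0 (rev_ord i)) *: delta_mx 0 i.
Proof.
move=> ni sc; have [t tr_t] := exists_trace1 sK s_nontriv.
have zz : hform (delta_mx 0 i) (delta_mx 0 i) = 0.
  by rewrite hform_deltar mxE eq_sym (negPf ni).
have [g gG gE] := exists_eichler sK pF (c * t) zz zz zz.
exists g => // v; rewrite gE hform_deltar -addrA -scalerBl; congr (_ + _ *: _).
by rewrite rmorphM sc -mulrBl mulNr opprK -mulrDr tr_t mulr1.
Qed.

Lemma transvection_std_stab (g : gT) c : g \in SUs ->
  (forall v : 'rV_d, v *m GLval g = v + (c * v 0 i0) *: e1) ->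
  g \in chain_stab s std_flag m.
Proof.
move=> gG gE; apply/chain_stabP; split=> // k km.
apply/row_subP=> i; rewrite row_mul gE.
have /sub_std_flagP h := row_sub i (std_flag k).
rewrite h; last by rewrite i0E; move: dm km; clear -m0; lia.
by rewrite mulr0 scale0r addr0 row_sub.
Qed.

(** A product g h g of opposite transvections with coefficients c, -1/c, c, as in the rank one
    computation in SL_2. It represents the reflection in alpha_m. *)
Lemma exists_middle_reflection : exists2 g : gT, g \in SUs &
  exists2 c, c != 0 & [/\ e0 *m GLval g = c *: e1, e1 *m GLval g = - c^-1 *: e0 &
    forall i, i != i0 -> i != i1 -> (delta_mx 0 i : 'rV_d) *m GLval g = delta_mx 0 i].
Proof.
have [a na] := s_nontriv; pose c := a - s a.
have c0 : c != 0 by rewrite subr_eq0 eq_sym.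
have sc : s c = - c by rewrite rmorphB sK opprB.
have scV : s (- c^-1) = - - c^-1 by rewrite rmorphN fmorphV sc invrN.
have n01 := i0_neq_i1.
have n1 : i1 != rev_ord i1 by rewrite rev_i1 eq_sym.
have n0 : i0 != rev_ord i0 by rewrite rev_i0.
have [g gG gE] := exists_transvection n1 sc.
have [h hG hE] := exists_transvection n0 scV.
rewrite rev_i1 in gE; rewrite rev_i0 in hE; clearbody c.
exists (g * h * g)%g; first exact: SUsM (SUsM gG hG) gG.
exists c => //; rewrite !GL_ME.
have dE (i j : 'I_d) : (delta_mx 0 i : 'rV[F]_d) 0 j = (j == i)%:R by rewrite mxE.
have e0g : e0 *m GLval g = e0 + c *: e1 by rewrite gE dE eqxx mulr1.
have e1g : e1 *m GLval g = e1 by rewrite gE dE (negPf n01) mulr0 scale0r addr0.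
have e0h : e0 *m GLval h = e0.
  by rewrite hE dE eq_sym (negPf n01) mulr0 scale0r addr0.
have e1h : e1 *m GLval h = e1 - c^-1 *: e0 by rewrite hE dE eqxx mulr1 scaleNr.
split.
- rewrite !mulmxA e0g mulmxDl -scalemxAl e0h e1h scalerBr scalerA mulfV // scale1r.
  by rewrite addrC subrK -scalemxAl e1g.
- rewrite !mulmxA e1g e1h mulmxBl -scalemxAl e0g e1g scalerDr scalerA mulVf //.
  by rewrite scale1r opprD addrC subrK scaleNr.
move=> i ni0 ni1.
have eg : (delta_mx 0 i : 'rV_d) *m GLval g = delta_mx 0 i.
  by rewrite gE dE eq_sym (negPf ni0) mulr0 scale0r addr0.
have eh : (delta_mx 0 i : 'rV_d) *m GLval h = delta_mx 0 i.
  by rewrite hE dE eq_sym (negPf ni1) mulr0 scale0r addr0.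
by rewrite !mulmxA eg eh eg.
Qed.

End StandardFlag.

(** * The parabolic subgroup P_m as a stabiliser *)

Section Parabolic.
Local Open Scope ring_scope.
Variables (F : finFieldType) (s : {rmorphism F -> F}) (m p q : nat).
Hypothesis sK : involutive s.
Hypothesis m0 : (0 < m)%N.
Local Notation n := (2 * m)%N.
Local Notation d := n.-1.+1.
Local Notation hform := (@hform F s n).
Local Notation perp := (@perp F s n _).
Local Notation gT := {'GL_n[F]}.
Local Notation SUs := (SUs s n).
Local Notation E := (@std_flag F n).
Hypothesis sE : forall a, s a = a ^+ q.
Hypothesis pF : p \in [pchar F].
Hypothesis s_nontriv : exists a, s a != a.
Hypothesis norm_surj : forall c, s c = c -> exists t, t * s t = c.
Local Notation i0 := (inord m.-1 : 'I_d).
Local Notation i1 := (inord m : 'I_d).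

Lemma dim_eq : d = (2 * m)%N. Proof. by move: m0; clear; lia. Qed.
Let dm := dim_eq.

Lemma SU_eq : SU F n q = SUs.
Proof.
apply/setP=> g; rewrite [LHS]inE [RHS]inE.
suff -> : map_mx s (GLval g) = map_mx (fun a => a ^+ q) (GLval g) by [].
by apply/matrixP=> i j; rewrite !mxE sE.
Qed.

Lemma SU_borel_eq : SU_borel F n q = chain_stab s E m.
Proof.
apply/setP=> g; rewrite [LHS]inE SU_eq; apply/andP/idP => [[gG gT]|gS].
  exact: upper_chain_stab_std.
split; first by case/chain_stabP: gS.
exact: (chain_stab_std_upper sK dm gS).
Qed.

Lemma simple_refl_m : SU_simple_refl m m = tperm i0 i1.
Proof. by rewrite /SU_simple_refl eqxx. Qed.

Lemma in_gen_simple_refl (w : 'S_d) :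
  (w \in <<[set t in map (SU_simple_refl m) [:: m]]>>%g) = (w == 1%g) || (w == tperm i0 i1).
Proof.
have -> : [set t in map (SU_simple_refl m) [:: m]] = [set tperm i0 i1].
  by apply/setP=> t; rewrite !inE simple_refl_m.
have t2 : #[tperm i0 i1]%g = 2%N.
  apply: nt_prime_order => //; first by rewrite expgS expg1 tperm2.
  apply/eqP=> t1; have := i0_neq_i1 dm m0.
  by rewrite -(tpermL i0 i1) t1 perm1 eqxx.
by rewrite -/(cycle _) (cycle2g t2) !inE.
Qed.

Lemma weyl_lift_stab (g : gT) : g \in SU_weyl_lift F m q [:: m] ->
  g \in chain_stab s E m.-1.
Proof.
rewrite [g \in SU_weyl_lift _ _ _ _]inE SU_eq => /andP[gG /existsP[w /andP[wt /forallP gw]]].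
rewrite in_gen_simple_refl in wt.
apply/chain_stabP; split=> // k km; apply/row_subP=> i; rewrite row_mul.
apply/sub_std_flagP=> i' j jk; rewrite mxE big1 // => t _.
have [tk|kt] := ltnP (t + k) d.
  have /sub_std_flagP h := row_sub i (E k); by rewrite h // mul0r.
have wtt : w t = t.
  case/orP: wt => /eqP ->; first by rewrite perm1.
  apply: tpermD; rewrite -val_eqE /= ?(i0E dm m0) ?(i1E dm m0);
    by move: kt km dm; clear -m0; lia.
have /forallP/(_ j)/eqP := gw t; rewrite wtt => gtj.
have : (GLval g t j != 0) = false.
  by rewrite gtj; apply/eqP=> jt; move: jk kt; rewrite jt; clear; lia.
by move/negbFE/eqP ->; rewrite mulr0.
Qed.

(* If [h] moves [E m], then [E m *m h] is also the image of [E m] under the middle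
   reflection followed by a transvection in the Borel subgroup. *)
Lemma SU_parabolic_eq : SU_parabolic F m q [:: m] = chain_stab s E m.-1.
Proof.
have BE := SU_borel_eq; rewrite /SU_parabolic BE.
have subB : chain_stab s E m \subset chain_stab s E m.-1.
  by apply: chain_stabW; apply: leq_pred.
apply/setP=> h; apply/idP/idP.
  case/mulsgP=> _ b2 /mulsgP[b1 w b1B /weyl_lift_stab wS ->] b2B ->.
  by apply: mem_GLM (mem_GLM _ wS) _; apply: (subsetP subB).
move=> hS; have [hG hE] := chain_stabP _ _ _ _ hS.
have one_lift : 1%g \in SU_weyl_lift F m q [:: m].
  rewrite [1%g \in SU_weyl_lift _ _ _ _]inE SU_eq SUs1 /=.
  apply/existsP; exists 1%g; rewrite group1 /=; apply/forallP=> i; apply/forallP=> j.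
  by rewrite perm1 GL_1E mxE (eq_sym j i); case: (i == j); rewrite ?oner_eq0 ?eqxx.
have memP b1 w b2 : b1 \in chain_stab s E m -> w \in SU_weyl_lift F m q [:: m] ->
    b2 \in chain_stab s E m -> (b1 * w * b2)%g \in (chain_stab s E m *
      SU_weyl_lift F m q [:: m] * chain_stab s E m)%g.
  by move=> h1 h2 h3; apply: mem_mulg h3; apply: mem_mulg.
have oneB : 1%g \in chain_stab s E m by exact: (group1 (chain_stab_group s E m)).
have [hm|nhm] := boolP (E m *m GLval h <= E m)%MS.
  rewrite -[h]mulg1 -[(h * 1)%g]mulg1; apply: memP => //.
  apply/chain_stabP; split=> // k; rewrite leq_eqVlt => /orP[/eqP ->//|km].
  by apply: hE; rewrite -ltnS prednK.
have stab1 : (E m.-1 *m GLval h <= E m.-1)%MS by apply: hE.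
have [u uh nuE] := exists_vec nhm.
have uE : (u <= E m.+1)%MS.
  have e : (d - m.-1 = m.+1)%N by move: dm; clear -m0; lia.
  have pE := perp_std_flag sK (k := m.-1) (_ : m.-1 <= d)%N.
  rewrite e in pE; rewrite -pE; last by move: dm; clear -m0; lia.
  rewrite (submx_trans uh) // (submx_trans _ (stable_perp sK hG stab1)) // submxMr //.
  by rewrite std_flag_perp //; move: dm; clear -m0; lia.
have uj (j : 'I_d) : (j < m.-1)%N -> u 0 j = 0.
  move=> jm; move/sub_std_flagP: uE; apply.
  by move: jm dm; clear -m0; lia.
have un0 : u 0 i0 != 0.
  apply: contra nuE => /eqP u0; apply/sub_std_flagP=> i j jm; rewrite ord1.
  have [->//|nj] := eqVneq j i0.
  apply: uj; move: nj; rewrite -val_eqE /= (i0E dm m0).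
  by move: jm dm; clear -m0; lia.
wlog u1 : u uh nuE uE uj un0 / u 0 i0 = 1.
  move=> /(_ ((u 0 i0)^-1 *: u)); apply.
  - by rewrite scalemx_sub.
  - apply: contra nuE => /(scalemx_sub (u 0 i0)).
    by rewrite scalerA mulfV // scale1r.
  - by rewrite scalemx_sub.
  - by move=> j jm; rewrite mxE (uj j jm) mulr0.
  - by rewrite mxE mulVf // oner_eq0.
  - by rewrite mxE mulVf.
(* Modulo E (m-1), u is e_(m-1) + b e_m, so its isotropy reads b + s b = 0: b is admissible as
   coefficient of a transvection. *)
pose b := u 0 i1.
have sb : s b = - b.
  have uu : hform u u = 0.
    apply: (hform_sub sK _ uh uh); rewrite SUs_perp // std_flag_perp //.
    by move: dm; clear -m0; lia.
  move: uu; rewrite hform_sum (bigD1 i0) //= (bigD1 i1) //=; last first.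
    by rewrite eq_sym (i0_neq_i1 dm m0).
  rewrite big1 => [|j /andP[j0 j1]]; last first.
    have [jm|mj] := ltnP j m.-1; first by rewrite (uj j) // rmorph0 mulr0.
    rewrite (uj (rev_ord j)) ?mul0r //= subSS.
    move: j0 j1; rewrite -!val_eqE /= (i0E dm m0) (i1E dm m0).
    by move: mj (ltn_ord j) dm; clear -m0; lia.
  rewrite (rev_i0 dm m0) (rev_i1 dm m0) u1 rmorph1 mulr1 mul1r addr0 -/b.
  by move/eqP; rewrite addrC addr_eq0 => /eqP.
have n1 : i1 != rev_ord i1 by rewrite (rev_i1 dm m0) eq_sym (i0_neq_i1 dm m0).
have [t tG tE] := exists_transvection sK pF s_nontriv n1 sb.
rewrite (rev_i1 dm m0) in tE.
have tB := transvection_std_stab dm m0 tG tE.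
have [w wG [c c0 [w0 w1 wi]]] := exists_middle_reflection sK dm m0 pF s_nontriv.
have wlift : w \in SU_weyl_lift F m q [:: m].
  rewrite [w \in SU_weyl_lift _ _ _ _]inE SU_eq wG /=.
  apply/existsP; exists (tperm i0 i1); rewrite in_gen_simple_refl eqxx orbT /=.
  apply/forallP=> i; apply/forallP=> j.
  have -> : GLval w i j = ((delta_mx 0 i : 'rV_d) *m GLval w) 0 j by rewrite -rowE mxE.
  have [->|ni0] := eqVneq i i0.
    by rewrite w0 tpermL !mxE eqxx /=; case: (j == i1); rewrite ?mulr1 ?c0 // mulr0 eqxx.
  have [->|ni1] := eqVneq i i1.
    rewrite w1 tpermR !mxE eqxx /=; case: (j == i0); last by rewrite mulr0 eqxx.
    by rewrite mulr1 oppr_eq0 invr_eq0 c0.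
  rewrite wi // tpermD 1?eq_sym // mxE eqxx /=.
  by case: (j == i); rewrite ?oner_eq0 ?eqxx.
have wS := weyl_lift_stab wlift; have tS := subsetP subB _ tB.
(* E m is spanned by E (m-1) and e_m. The former is stable under h and w t; the latter goes under w
   t to a multiple of e_(m-1) + b e_m, which is u modulo E (m-1). *)
have hE' : (E m *m GLval (w * t)%g :=: E m *m GLval h)%MS.
  apply: eqmx_of_sub; last by rewrite !rankGL.
  apply/row_subP=> i; rewrite row_mul; set v := row i (E m).
  have vE : (v <= E m)%MS by rewrite row_sub.
  clearbody v.
  have vdec : v = (v - v 0 i1 *: delta_mx 0 i1) + v 0 i1 *: delta_mx 0 i1 by rewrite subrK.
  have v'E : (v - v 0 i1 *: delta_mx 0 i1 <= E m.-1)%MS.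
    apply/sub_std_flagP=> i' j jm; rewrite !mxE ord1 eqxx /=.
    have [->|nj] := eqVneq j i1; first by rewrite mulr1 subrr.
    rewrite mulr0 subr0; move/sub_std_flagP: vE; apply.
    by move: nj jm; rewrite -val_eqE /= (i1E dm m0); move: dm; clear -m0; lia.
  have Eh : (E m.-1 <= E m *m GLval h)%MS.
    apply: submx_trans (submxMr _ (std_flagS F n (leq_pred m))).
    have := stable_GLV stab1; move/(submxMr (GLval h)); by rewrite mulGLKV.
  have wtS := mem_GLM wS tS; have [_ wtE] := chain_stabP _ _ _ _ wtS.
  rewrite vdec mulmxDl addmx_sub //.
    by rewrite (submx_trans (submxMr _ v'E)) // (submx_trans (wtE _ (leqnn _))).
  rewrite -scalemxAl scalemx_sub // GL_ME mulmxA w1 -scalemxAl scalemx_sub //.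
  rewrite tE mxE !eqxx mulr1.
  have -> : delta_mx 0 i0 + b *: delta_mx 0 i1
     = u - (u - (delta_mx 0 i0 + b *: delta_mx 0 i1)) :> 'rV_d by rewrite subKr.
  rewrite addmx_sub // eqmx_opp (submx_trans _ Eh) //.
  apply/sub_std_flagP=> i' j jm; rewrite !mxE ord1 eqxx /=.
  have [->|nj0] := eqVneq j i0.
    by rewrite u1 (negPf (i0_neq_i1 dm m0)) mulr0 addr0 subrr.
  have [->|nj1] := eqVneq j i1; first by rewrite add0r mulr1 subrr.
  rewrite mulr0 addr0 subr0 uj //.
  move: nj0 nj1 jm; rewrite -!val_eqE /= (i0E dm m0) (i1E dm m0).
  by move: dm; clear -m0; lia.
have bB : (h * (w * t)^-1)%g \in chain_stab s E m.
  apply/chain_stabP; split=> [|k km].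
    exact: SUsM hG (SUsV (SUsM wG tG)).
  rewrite GL_ME mulmxA; have [->|nk] := eqVneq k m.
    by rewrite -(eqmxMr _ hE') mulGLK.
  have km1 : (k <= m.-1)%N by rewrite -ltnS prednK // ltn_neqAle nk.
  have /chain_stabP[_ wtE] := mem_GLM wS tS.
  rewrite (submx_trans (submxMr _ (hE _ km1))) // stable_GLV //.
  exact: wtE.
have -> : h = (h * (w * t)^-1 * w * t)%g by rewrite -[RHS]mulgA mulgKV.
exact: memP.
Qed.

Lemma chain_stab_conj (C D : nat -> 'M[F]_d) r g : g \in SUs ->
  (forall k, (k <= r)%N -> (C k *m GLval g :=: D k)%MS) ->
  chain_stab s D r = (chain_stab s C r :^ g)%g.
Proof.
move=> gG CD; apply/setP=> h; rewrite mem_conjg.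
have -> : (h ^ g^-1 = g * (h * g^-1))%g by rewrite conjgE invgK.
have stabE k : (k <= r)%N ->
    (D k *m GLval h <= D k)%MS = (C k *m GLval (g * (h * g^-1))%g <= C k)%MS.
  move=> kr; rewrite !GL_ME !mulmxA -[in RHS](submxGL g) mulGLKV.
  by rewrite CD // -(eqmxMr _ (CD k kr)).
apply/chain_stabP/chain_stabP=> [[hG hD]|[hG hC]].
  by split=> [|k kr]; [exact: SUsM gG (SUsM hG (SUsV gG))|rewrite -stabE ?hD].
split=> [|k kr]; last by rewrite stabE ?hC.
have := SUsM (SUsM (SUsV gG) hG) gG.
by rewrite mulKg -mulgA mulVg mulg1.
Qed.

(** An isotropic vector y orthogonal to W (m-1) completes the W_i to a full flag, conjugate to the
    standard one. The choice of y is immaterial, as both stabilisers involve dimensions below m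
    only. *)
Lemma SubG_conj_parabolic (x : gT) l : x \in SUs ->
  (GLval x - 1%:M) ^+ l = 0 -> has_jordan_type [:: n.-1; 1]%N x ->
  exists2 g : gT, g \in SUs & SubG SUs x = (SU_parabolic F m q [:: m] :^ g)%g.
Proof.
move=> xG Nl xJ; have n0 : (0 < n)%N by move: m0; clear; lia.
pose W := im_flag x; have rW := rank_im_flag dm m0 n0 Nl xJ.
have m1 : (m.-1 < m)%N by move: m0; clear; lia.
have WW : (W m.-1 <= perp (W m.-1))%MS by apply: (im_flag_isotropic sK dm m0 n0 xG Nl xJ).
have [|y yW /andP[nyW /eqP yy]] := exists_isotropic_rel sK norm_surj WW.
  by rewrite (rank_perpE s dm) rW //; move: m0; clear; lia.
pose D k := if (k < m)%N then W k else (W m.-1 + y)%MS.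
have fD : isflag s m D.
  split=> [k|k km|]; rewrite /D.
  - rewrite leq_eqVlt => /orP[/eqP ->|km]; last by rewrite km rW.
    by rewrite ltnn rank_adds_vec // rW // prednK.
  - rewrite km; case: ifP => [km1|]; first exact: (im_flag_sub dm).
    move/negbT; rewrite -leqNgt => mk; have -> : k = m.-1 by move: km mk; clear; lia.
    exact: addsmxSl.
  rewrite ltnn; apply: isotropic_adds => //.
  by rewrite hform_perp yy.
have [g gG gD] := SUs_flag_trans sK dm pF s_nontriv m0 (isflag_std sK dm) fD.
exists g => //; rewrite (SubG_almost_regular sK pF dm m0 n0 xG Nl xJ) SU_parabolic_eq.
apply: chain_stab_conj => // k km; have {}km : (k < m)%N := leq_ltn_trans km m1.
by have := gD k (ltnW km); rewrite /D km.
Qed.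

End Parabolic.

(** * The involution and the norm of a finite field *)

Section FiniteFields.
Local Open Scope ring_scope.

Lemma exists_frobenius (F : finFieldType) p e : p \in [pchar F] ->
  exists s : {rmorphism F -> F}, forall a, s a = a ^+ (p ^ e).
Proof.
move=> pF; elim: e => [|e [s sE]]; first by exists idfun => a; rewrite expr1.
exists [the {rmorphism F -> F} of pFrobenius_aut pF \o s] => a /=.
by rewrite sE pFrobenius_autE expnSr exprM.
Qed.

Lemma exists_not_fixed_expn (F : finFieldType) q : (1 < q < #|F|)%N ->
  exists a : F, a ^+ q != a.
Proof.
move=> /andP[q1 qF]; apply/existsP; apply: contraLR qF; rewrite negb_exists -leqNgt.
move=> /forallP fixF; pose P : {poly F} := 'X^q - 'X.
have sP : size P = q.+1 by rewrite size_polyDl size_polyXn // size_polyN size_polyX.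
have P0 : P != 0 by rewrite -size_poly_eq0 sP.
have := max_poly_roots P0 _ (enum_uniq F); rewrite -cardE sP ltnS; apply.
apply/allP=> a _; rewrite /root !hornerE subr_eq0.
by have := fixF a; rewrite negbK.
Qed.

(** The unit group is cyclic of order (q-1)(q+1), generated by z. If c = z^k satisfies c^(q-1) = 1,
    then q+1 divides k and t = z^(k/(q+1)) has norm c. *)
Lemma norm_surjective (F : finFieldType) q (c : F) : (1 < q)%N -> #|F| = (q ^ 2)%N ->
  c ^+ q = c -> exists t, t * t ^+ q = c.
Proof.
move=> q1 cF cq; have q0 : (0 < q)%N := ltnW q1.
have [->|c0] := eqVneq c 0; first by exists 0; rewrite mul0r.
have /cyclicP[z Fz] := field_unit_group_cyclic [set: {unit F}]%G.
have cU : c \is a GRing.unit by rewrite unitfE.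
have /cycleP[k ck] : FinRing.unit F cU \in <[z]>%g by rewrite -Fz inE.
have oz : #[z]%g = ((q - 1) * (q + 1))%N.
  by rewrite orderE -Fz card_finField_unit cF -subn_sqr exp1n subn1.
have ck' : c = val z ^+ k by rewrite -FinRing.val_unitX -ck.
have dvd : ((q - 1) * (q + 1) %| k * (q - 1))%N.
  rewrite -oz order_dvdn; apply/eqP/val_inj; rewrite FinRing.val_unitX FinRing.val_unit1.
  rewrite exprM -ck'; apply: (mulfI c0); rewrite mulr1 -exprS.
  by rewrite -addn1 subnK // cq.
move: dvd; rewrite mulnC dvdn_pmul2r ?subn_gt0 // => /dvdnP[j kE].
exists (val z ^+ j); rewrite -exprM -exprD ck' kE; congr (_ ^+ _).
by rewrite mulnDr muln1 addnC.
Qed.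

End FiniteFields.

Theorem lemma3p10 (p e q m : nat) (F : finFieldType) (x : {'GL_(2 * m)[F]}) :
  prime p -> (0 < e)%N -> q = (p ^ e)%N -> #|F| = (q ^ 2)%N -> (1 <= m)%N ->
  x \in SU F (2 * m)%N q -> unipotent x ->
  (~ regular_unipotent x -> ~ has_jordan_type [:: (2 * m).-1; 1]%N x ->
     SubG (SU F (2 * m)%N q) x = SU F (2 * m)%N q) /\
  (has_jordan_type [:: (2 * m).-1; 1]%N x ->
     exists2 g : {'GL_(2 * m)[F]}, g \in SU F (2 * m)%N q &
       SubG (SU F (2 * m)%N q) x = SU_parabolic F m q [:: m] :^ g).
Proof.
move=> p_pr e0 qE cF m0 xG [l Nl].
have pF : p \in [pchar F]%R.
  by apply: (card_finPcharP (n := (e * 2)%N)) => //; rewrite cF qE expnM.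
have [s sE] := exists_frobenius e pF; rewrite -qE in sE.
have sK : involutive s by move=> a; rewrite !sE -GRing.exprM mulnn -cF expf_card.
have q1 : (1 < q)%N.
  by rewrite qE -(exp1n e) ltn_exp2r // prime_gt1.
have s_nontriv : exists a, s a != a.
  have [|a] := @exists_not_fixed_expn F q; last by rewrite -sE; exists a.
  by rewrite q1 cF -mulnn ltn_Pmull // ltnW.
have norm_surj c : s c = c -> exists t, (t * s t = c)%R.
  rewrite sE => /(norm_surjective q1 cF)[t tE]; exists t; by rewrite sE.
rewrite (SU_eq m sE) in xG *; have dm := dim_eq m0.
split=> [nreg nJ|xJ]; last exact: (SubG_conj_parabolic sK m0 sE pF s_nontriv norm_surj xG Nl xJ).
have [m1|m1] := ltnP 1 m; last first.
  have e1 : m = 1%N by apply/eqP; rewrite eqn_leq m1.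
  by case: (regular_or_trivial_dim2 dm e1 Nl).
have [[L [rL LL LN]]|//|//] := fix_isotropic_or_jordan sK norm_surj dm xG Nl m1.
exact: (SubG_full sK pF s_nontriv norm_surj dm xG Nl m1 rL LL LN).
Qed.
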